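(* Let $(M,\pi)$ be an $N$-dimensional Poisson manifold and let $X$ be a Poisson vector field on $(M,\pi)$, written in local coordinates as $X=\sum_{i=1}^N v^i(\mathbf{x})\frac{\partial}{\partial x^i}$. Then the complete lift $X_C$ and the vertical lift $X_V$ of $X$, given in the induced coordinates $(\mathbf{x},\mathbf{y})$ on $TM$ by $$X_{C}=\sum_{i=1}^N v^i(\mathbf{x})\frac{\partial}{\partial x^i}+\sum_{i,s=1}^N \frac{\partial v^i}{\partial x^s}(\mathbf{x})\,y^s\frac{\partial}{\partial y^i},\qquad X_{V}=\sum_{i=1}^N v^i(\mathbf{x})\frac{\partial}{\partial y^i},$$ are Poisson vector fields on the Poisson manifold $(TM,\pi_{TM})$.
   Context: All manifolds, functions and tensors are smooth. A Poisson manifold $(M,\pi)$ is a manifold with a bivector field $\pi$ whose bracket $\{f,g\}=\pi(df,dg)=\sum_{i,j}\pi^{ij}\frac{\partial f}{\partial x^i}\frac{\partial g}{\partial x^j}$ (with $\pi^{ij}=\{x^i,x^j\}$) satisfies the Jacobi identity. A vector field $X$ on a Poisson manifold $(M,\pi)$ is a Poisson vector field if $\mathcal{L}_X\pi=0$, equivalently $X(\{f,g\})-\{X(f),g\}-\{f,X(g)\}=0$ for all smooth $f,g$. Local coordinates $\mathbf{x}=(x^1,\dots,x^N)$ on $M$ induce coordinates $(\mathbf{x},\mathbf{y})=(x^1,\dots,x^N,y^1,\dots,y^N)$ on $TM$, where $y^i$ is the fiber-wise linear function defined by $dx^i$. The Poisson tensor $\pi_{TM}$ on $TM$ induced by $\pi$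 (the fiber-wise linear Poisson structure dual to the Lie algebroid $T^*M$) is given by $$\pi_{TM}(\mathbf{x},\mathbf{y})=\sum_{i,j=1}^{N} \pi^{ij}(\mathbf{x})\frac{\partial}{\partial x^i}\wedge \frac{\partial}{\partial y^j}+\frac12\sum_{i,j,s=1}^{N}\frac{\partial\pi^{ij}}{\partial x^s}(\mathbf{x})\,y^s\frac{\partial}{\partial y^i}\wedge \frac{\partial}{\partial y^j},$$ i.e. $\{x^i,x^j\}_{TM}=0$, $\{x^i,y^j\}_{TM}=\pi^{ij}(\mathbf{x})$, $\{y^i,y^j\}_{TM}=\sum_s\frac{\partial \pi^{ij}}{\partial x^s}(\mathbf{x})y^s$. *)

(* Defs.v *)
From HB Require Import structures.
From mathcomp Require Import all_boot all_order all_algebra.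
From mathcomp Require Import all_classical all_reals all_analysis.
Set Implicit Arguments.
Unset Strict Implicit.
Unset Printing Implicit Defensive.
Import Order.TTheory GRing.Theory Num.Theory.
Import numFieldNormedType.Exports.
Local Open Scope classical_set_scope.
Local Open Scope ring_scope.

(* Points of R^n are row vectors; the Jacobian matrix of the library acts on
   them from the right, ('J f x) k i being the derivative of f^i along x^k. *)

Definition pderiv (R : realType) (n : nat) (i : 'I_n) (f : 'rV[R]_n -> R) :
    'rV[R]_n -> R :=
  fun x => 'D_(delta_mx 0 i : 'rV[R]_n) f x.

Fixpoint diff_on (R : realType) (n k : nat) (U : set 'rV[R]_n)
    (f : 'rV[R]_n -> R) : Prop :=
  match k with
  | 0 => forall x, U x -> continuous_at x f
  | k'.+1 => (forall x, U x -> differentiable f x) /\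
             (forall i : 'I_n, diff_on k' U (pderiv i f))
  end.

(* Meant for U open.  A k times differentiable function is C^(k-1), so asking
   for all k gives C^infinity. *)
Definition smooth_on (R : realType) (n : nat) (U : set 'rV[R]_n)
    (f : 'rV[R]_n -> R) : Prop :=
  forall k, diff_on k U f.

Definition smooth_map_on (R : realType) (n m : nat) (U : set 'rV[R]_n)
    (f : 'rV[R]_n -> 'rV[R]_m) : Prop :=
  forall i : 'I_m, smooth_on U (fun x => f x 0 i).

(* Raw data of an n-dimensional atlas on a bare set of points; the axioms are
   in [manifold].  [param c] is the inverse of [chart c]; both are total, and
   are meaningless outside [dom c] and [chart c @` dom c].  [chart_at] selects
   a chart around each point; it only serves to write down tangent vectors. *)
Record atlas (R : realType) (n : nat) : Type := Atlas {
  point : Type;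
  index : Type;
  dom : index -> set point;
  chart : index -> point -> 'rV[R]_n;
  param : index -> 'rV[R]_n -> point;
  chart_at : point -> index
}.
Arguments dom {R n} a _ _.
Arguments chart {R n} a _ _.
Arguments param {R n} a _ _.
Arguments chart_at {R n} a _.

Definition transition (R : realType) (n : nat) (M : atlas R n)
    (c d : index M) : 'rV[R]_n -> 'rV[R]_n :=
  fun x => chart M d (param M c x).

Definition overlap (R : realType) (n : nat) (M : atlas R n)
    (c d : index M) : set 'rV[R]_n :=
  chart M c @` (dom M c `&` dom M d).

(* the topology of the manifold, induced by the atlas *)
Definition open_in (R : realType) (n : nat) (M : atlas R n)
    (W : set (point M)) : Prop :=
  forall c, open (chart M c @` (W `&` dom M c)).

(* Second countability is expressed by a countable subatlas. *)
Definition manifold (R : realType) (n : nat) (M : atlas R n) : Prop :=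
  [/\ forall p, dom M (chart_at M p) p,
      forall c p, dom M c p -> param M c (chart M c p) = p,
      forall c d : index M, open (overlap c d) /\
                            smooth_map_on (overlap c d) (transition c d),
      forall p q : point M, p <> q -> exists V W : set (point M),
        [/\ open_in V, open_in W, V p, W q & V `&` W = set0]
    & exists2 J : set (index M), countable J &
        forall p, exists2 c, J c & dom M c p].

Definition smooth_fun (R : realType) (n : nat) (M : atlas R n)
    (W : set (point M)) (f : point M -> R) : Prop :=
  forall c, smooth_on (chart M c @` (W `&` dom M c)) (f \o param M c).

(* Contravariant tensor fields are given by their components in each chart, as
   functions of the coordinates, subject to the tensor transformation law:
   [X c x 0 i] is the component of d/dx^i of a vector field, and [P c x i j] is
   the component pi^{ij} = {x^i, x^j} of a bivector field. *)
Definition vcomponents (R : realType) (n : nat) (M : atlas R n) : Type :=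
  index M -> 'rV[R]_n -> 'rV[R]_n.

Definition bcomponents (R : realType) (n : nat) (M : atlas R n) : Type :=
  index M -> 'rV[R]_n -> 'M[R]_n.

Definition vector_field (R : realType) (n : nat) (M : atlas R n)
    (X : vcomponents M) : Prop :=
  (forall c, smooth_map_on (chart M c @` dom M c) (X c)) /\
  (forall c d x, overlap c d x ->
     X d (transition c d x) = X c x *m 'J (transition c d) x).

Definition bivector_field (R : realType) (n : nat) (M : atlas R n)
    (P : bcomponents M) : Prop :=
  [/\ forall c i j, smooth_on (chart M c @` dom M c) (fun x => P c x i j),
      forall c x, (chart M c @` dom M c) x -> (P c x)^T = - P c x
    & forall c d x, overlap c d x ->
        P d (transition c d x) =
          ('J (transition c d) x)^T *m P c x *m 'J (transition c d) x].

(* The function df/dx^i on [dom c], where the x^i are the coordinates of c. *)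
Definition coord_deriv (R : realType) (n : nat) (M : atlas R n) (c : index M)
    (i : 'I_n) (f : point M -> R) : point M -> R :=
  fun p => pderiv i (f \o param M c) (chart M c p).

(* {f, g} and X(f) on [dom c], computed in the coordinates of c; by the
   transformation laws the values do not depend on c. *)
Definition bracket (R : realType) (n : nat) (M : atlas R n)
    (P : bcomponents M) (c : index M) (f g : point M -> R) : point M -> R :=
  fun p => \sum_(i < n) \sum_(j < n)
    P c (chart M c p) i j * coord_deriv c i f p * coord_deriv c j g p.

Definition vf_apply (R : realType) (n : nat) (M : atlas R n)
    (X : vcomponents M) (c : index M) (f : point M -> R) : point M -> R :=
  fun p => \sum_(i < n) X c (chart M c p) 0 i * coord_deriv c i f p.

(* Functions are smooth functions on arbitrary open subsets of M, so that both
   global functions (W = setT) and coordinate functions are allowed. *)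
Definition jacobi (R : realType) (n : nat) (M : atlas R n)
    (P : bcomponents M) : Prop :=
  forall W : set (point M), open_in W -> forall f g h : point M -> R,
  smooth_fun W f -> smooth_fun W g -> smooth_fun W h ->
  forall c p, W p -> dom M c p ->
    bracket P c f (bracket P c g h) p + bracket P c g (bracket P c h f) p +
    bracket P c h (bracket P c f g) p = 0.

Definition poisson_manifold (R : realType) (n : nat) (M : atlas R n)
    (P : bcomponents M) : Prop :=
  [/\ manifold M, bivector_field P & jacobi P].

Definition poisson_vector_field (R : realType) (n : nat) (M : atlas R n)
    (P : bcomponents M) (X : vcomponents M) : Prop :=
  vector_field X /\
  forall W : set (point M), open_in W -> forall f g : point M -> R,
  smooth_fun W f -> smooth_fun W g ->
  forall c p, W p -> dom M c p ->
    vf_apply X c (bracket P c f g) p - bracket P c (vf_apply X c f) g p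
      - bracket P c f (vf_apply X c g) p = 0.

(* The tangent bundle.  A tangent vector at p is the row w of its components in
   the chart [chart_at M p]; its components in another chart around p follow by
   the transformation law.  The induced coordinates (x, y) of a tangent vector
   are [row_mx x y], with y^i = dx^i. *)
Definition tangent_bundle (R : realType) (n : nat) (M : atlas R n) :
    atlas R (n + n) := {|
  point := (point M * 'rV[R]_n)%type;
  index := index M;
  dom := fun c q => dom M c q.1;
  chart := fun c q =>
    let a := chart_at M q.1 in
    row_mx (chart M c q.1) (q.2 *m 'J (transition a c) (chart M a q.1));
  param := fun c z =>
    let p := param M c (lsubmx z) in
    (p, rsubmx z *m 'J (transition c (chart_at M p)) (lsubmx z));
  chart_at := fun q => chart_at M q.1
|}.

(* {x^i, x^j} = 0, {x^i, y^j} = pi^{ij}, {y^i, x^j} = - pi^{ji},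
   {y^i, y^j} = sum_s dpi^{ij}/dx^s y^s *)
Definition tangent_poisson (R : realType) (n : nat) (M : atlas R n)
    (P : bcomponents M) : bcomponents (tangent_bundle M) :=
  fun c (z : 'rV[R]_(n + n)) =>
    let x : 'rV[R]_n := lsubmx z in
    let y : 'rV[R]_n := rsubmx z in
    block_mx 0 (P c x) (- (P c x)^T)
      (\matrix_(i < n, j < n)
         \sum_(s < n) pderiv s (fun u => P c u i j) x * y 0 s).

Definition complete_lift (R : realType) (n : nat) (M : atlas R n)
    (X : vcomponents M) : vcomponents (tangent_bundle M) :=
  fun c (z : 'rV[R]_(n + n)) =>
    let x : 'rV[R]_n := lsubmx z in
    let y : 'rV[R]_n := rsubmx z in
    row_mx (X c x)
      (\row_(i < n) \sum_(s < n) pderiv s (fun u => X c u 0 i) x * y 0 s).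

Definition vertical_lift (R : realType) (n : nat) (M : atlas R n)
    (X : vcomponents M) : vcomponents (tangent_bundle M) :=
  fun c (z : 'rV[R]_(n + n)) => row_mx 0 (X c (lsubmx z)).

(* Main.v *)
Require Import Defs.
From mathcomp Require Import all_boot all_order all_algebra.
From mathcomp Require Import all_classical all_reals all_analysis.
From mathcomp Require Import ring lra.
Set Implicit Arguments.
Unset Strict Implicit.
Unset Printing Implicit Defensive.
Import Order.TTheory GRing.Theory Num.Theory.
Import numFieldNormedType.Exports.
Local Open Scope classical_set_scope.
Local Open Scope ring_scope.

(** The whole argument is differentiation of known identities.  A function F
    on an open set of R^n gives two functions on its product with R^n: the
    pullback F(x), and the total derivative [tdiff F] = sum_s d_sF(x) y^s.
    Writing a tensor on TM in induced coordinates only involves these two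
    operations, and they obey
      d/dx^k (F(x)) = (d_kF)(x),       d/dy^k (F(x)) = 0,
      d/dx^k (tdiff F) = tdiff (d_kF), d/dy^k (tdiff F) = (d_kF)(x),
    the third rule being the symmetry of second derivatives ([pderivC]).
    Moreover [tdiff] is a derivation over the pullback, and is natural:
    tdiff (F o phi) is tdiff F composed with the tangent map of phi.

    Both the Jacobi identity and the invariance of a bivector under a vector
    field are equivalent to the vanishing, in every chart, of components that
    are of first order in the tensors: the jacobiator of pi, and the Lie
    derivative of pi along X ([jacobiP], [poisson_vector_fieldP]).  In one
    direction one tests the bracket identity on the coordinate functions of
    the chart; in the other all second derivatives of the test functions
    cancel, by symmetry ([jacobi_lbracket], [lie_lbracket]).

    On TM, each component of the jacobiator of pi_TM is then 0, a component of
    the jacobiator of pi, or its total derivative, according as at most one,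
    exactly two or all three of its indices are fibre indices
    ([jacobiator_lift]); and likewise for the Lie derivatives of pi_TM along
    X_C and X_V ([lie_bivector_complete], [lie_bivector_vertical]).  All of
    them vanish.

    There remains to see that the objects on TM exist globally.  A change of
    induced coordinates is the tangent map of a change of coordinates phi, and
    its Jacobian matrix has blocks J, tdiff J, 0, J, where J is the Jacobian
    matrix of phi ([jacobian_tangent_map]).  The transformation laws of the
    lifts are those of pi and X, together with their total derivatives
    ([lift_bivector_transform], [lift_vector_transform]). *)

(** * Differentiability *)

Section DifferentialComplements.
Variable R : realType.

(** The differential of f is also a first-order approximation of g, because
    the little-o condition only looks at a neighbourhood of the point. *)
Lemma near_eq_differentiable (V W : normedModType R) (f g : V -> W) (x : V) :
  (\forall y \near x, f y = g y) -> differentiable f x -> differentiable g x.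
Proof.
move=> fg dfx; have fgx := nbhs_singleton fg.
have [dfc fE] := (diff_locallyP _ _).1 dfx.
have gE : g \o shift x = cst (g x) + 'd f x +o_ 0 id.
  apply/eqaddoP => eps eps0.
  have := (eqaddoP _ _ _ _).1 fE eps eps0 => near_f.
  have fg0 : \forall h \near (0 : V), f (h + x) = g (h + x).
    have : (fun h : V => h + x) @ (0 : V) --> x.
      rewrite -[X in _ --> X]add0r.
      by apply: cvgD; [exact: cvg_id|exact: cvg_cst].
    by move=> /(_ _ fg).
  near=> h.
  have -> : (g \o shift x - (cst (g x) + 'd f x)) h =
            (f \o shift x - (cst (f x) + 'd f x)) h.
    rewrite /= !fctE /= fgx; congr (_ - _).
    by rewrite (near fg0 h).
  by near: h.
have dE := diff_unique dfc gE.
by apply/diff_locallyP; rewrite dE.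
Unshelve. all: by end_near. Qed.

Lemma differentiable_rowP (V : normedModType R) n (f : V -> 'rV[R]_n) (x : V) :
  (forall i, differentiable (fun y => f y 0 i) x) -> differentiable f x.
Proof.
move=> df.
have -> : f = \sum_(i < n) (fun y => f y 0 i *: (delta_mx 0 i : 'rV[R]_n)).
  by rewrite fct_sumE; apply/funext => y; rewrite -row_sum_delta.
by apply: differentiable_sum => i; exact: differentiableZl.
Qed.

(** The difference quotients on both sides are the same functions of the
    increment. *)
Lemma is_derive_line (V : normedModType R) (F : V -> R) (y v : V) (t : R) :
  differentiable F (y + t *: v) ->
  is_derive t 1 (fun s => F (y + s *: v)) ('D_v F (y + t *: v)).
Proof.
move=> dF.
have E : (fun h : R => h^-1 *: (((fun s => F (y + s *: v)) \o shift t) (h *: 1)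
            - F (y + t *: v))) =
         (fun h : R => h^-1 *: ((F \o shift (y + t *: v)) (h *: v)
            - F (y + t *: v))).
  apply/funext => h /=; congr (_ *: (F _ - _)).
  by rewrite [h *: 1]mulr1 scalerDl addrCA.
split.
  by rewrite /derivable E; apply: diff_derivable.
by rewrite /derive E.
Qed.

End DifferentialComplements.

(** * Partial derivatives *)

Section PartialDerivatives.
Variables (R : realType) (n : nat).
Implicit Types (f g : 'rV[R]_n -> R) (x : 'rV[R]_n) (i j : 'I_n).

Lemma near_pderiv f g x i :
  (\forall y \near x, f y = g y) -> pderiv i f x = pderiv i g x.
Proof. exact: near_eq_derive. Qed.

Lemma open_near (U : set 'rV[R]_n) x (P : 'rV[R]_n -> Prop) :
  open U -> U x -> (forall y, U y -> P y) -> \forall y \near x, P y.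
Proof.
move=> oU Ux UP; have : nbhs x U by exact: open_nbhs_nbhs.
by apply: filterS.
Qed.

Lemma pderiv_cst (a : R) x i : pderiv i (fun=> a) x = 0.
Proof. exact: derive_cst. Qed.

Lemma pderiv_coord x i j : pderiv i (fun y => y 0 j) x = (i == j)%:R.
Proof.
have dj : differentiable (fun y : 'rV[R]_n => y 0 j) x.
  exact: differentiable_coord.
rewrite /pderiv.
have -> : 'D_('e_i) (fun y : 'rV[R]_n => y 0 j) x = (delta_mx 0 i : 'rV[R]_n) 0 j.
  have := @derive_id R _ x (delta_mx 0 i : 'rV[R]_n).
  rewrite derive_mx; last exact: derivable_id.
  by move=> /matrixP /(_ 0 j); rewrite mxE.
by rewrite mxE eqxx /= eq_sym.
Qed.

Lemma pderivN f x i : differentiable f x ->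
  pderiv i (fun y => - f y) x = - pderiv i f x.
Proof. by move=> df; apply: deriveN; exact: diff_derivable. Qed.

Lemma pderivD f g x i : differentiable f x -> differentiable g x ->
  pderiv i (fun y => f y + g y) x = pderiv i f x + pderiv i g x.
Proof. by move=> df dg; apply: deriveD; exact: diff_derivable. Qed.

Lemma pderivM f g x i : differentiable f x -> differentiable g x ->
  pderiv i (fun y => f y * g y) x = pderiv i f x * g x + f x * pderiv i g x.
Proof.
move=> df dg; rewrite /pderiv deriveM; [|exact: diff_derivable..].
by rewrite addrC /GRing.scale /= [X in X + _]mulrC.
Qed.

Lemma pderiv_sum m (F : 'I_m -> 'rV[R]_n -> R) x i :
  (forall k, differentiable (F k) x) ->
  pderiv i (fun y => \sum_(k < m) F k y) x = \sum_(k < m) pderiv i (F k) x.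
Proof.
move=> dF; rewrite -fct_sumE /pderiv derive_sum // => k.
exact: diff_derivable.
Qed.

Lemma jacobianE m (phi : 'rV[R]_n -> 'rV[R]_m) x i (k : 'I_m) :
  differentiable phi x ->
  'J phi x i k = pderiv i (fun y => phi y 0 k) x.
Proof.
move=> dphi; rewrite /pderiv.
have := deriveEjacobian (delta_mx 0 i) dphi.
rewrite derive_mx; last exact: diff_derivable.
move=> /matrixP /(_ 0 k); rewrite mxE => ->.
by rewrite -rowE [RHS]mxE.
Qed.

(** The chain rule, by expanding the image of the basis vector under the
    differential of phi in the standard basis. *)
Lemma pderiv_comp m (phi : 'rV[R]_n -> 'rV[R]_m) (g : 'rV[R]_m -> R) x i :
  differentiable phi x -> differentiable g (phi x) ->
  pderiv i (g \o phi) x =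
  \sum_(k < m) pderiv i (fun y => phi y 0 k) x * pderiv k g (phi x).
Proof.
move=> dphi dg; rewrite /pderiv deriveE; last exact: differentiable_comp.
rewrite diff_comp //= -(deriveE _ dphi) deriveEjacobian // -rowE.
rewrite (row_sum_delta (row i ('J phi x))) linear_sum; apply: eq_bigr => k _.
by rewrite linearZ /= -deriveE // mxE jacobianE.
Qed.

End PartialDerivatives.

(** * Smooth functions *)

Section Smooth.
Variables (R : realType) (n : nat).
Implicit Types (U V : set 'rV[R]_n) (f g : 'rV[R]_n -> R) (i j : 'I_n).

(** The levels of [diff_on] are nested because differentiability implies
    continuity; this makes f itself available at the level of its partial
    derivatives, as the Leibniz rule requires. *)
Lemma diff_onW k U f : diff_on k.+1 U f -> diff_on k U f.
Proof.
elim: k f => [|k IH] f [df dpf].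
  by move=> x Ux; exact: differentiable_continuous (df x Ux).
by split => // i; apply: IH; exact: dpf.
Qed.

Lemma eq_diff_on k U f g : open U -> (forall x, U x -> f x = g x) ->
  diff_on k U f -> diff_on k U g.
Proof.
move=> oU; elim: k f g => [|k IH] f g fg.
  move=> cf x Ux; have fgx : {near x, f =1 g} by exact: (open_near oU).
  rewrite /continuous_at -(fg _ Ux).
  exact: cvg_trans (near_eq_cvg fgx) (cf _ Ux).
move=> [df dpf]; split=> [x Ux|i].
  by apply: near_eq_differentiable (df _ Ux); exact: (open_near oU).
apply: IH (dpf i) => x Ux; apply: near_pderiv; exact: (open_near oU).
Qed.

Lemma eq_smooth_on U f g : open U -> (forall x, U x -> f x = g x) ->
  smooth_on U f -> smooth_on U g.
Proof. by move=> oU fg sf k; apply: eq_diff_on fg (sf k). Qed.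

Lemma sub_smooth_on U V f : V `<=` U -> smooth_on U f -> smooth_on V f.
Proof.
move=> VU sf k; move: (sf k) => {sf}; elim: k f => [|k IH] f /=.
  by move=> cf x /VU; exact: cf.
by move=> [df dpf]; split=> [x /VU|i]; [exact: df|exact: IH (dpf i)].
Qed.

Lemma smooth_diff U f x : smooth_on U f -> U x -> differentiable f x.
Proof. by move=> /(_ 1) [df _]; exact: df. Qed.

Lemma smooth_pderiv U f i : smooth_on U f -> smooth_on U (pderiv i f).
Proof. by move=> sf k; have [_] := sf k.+1; apply. Qed.

Lemma smooth_cst U (a : R) : smooth_on U (fun=> a).
Proof.
move=> k; elim: k a => [|k IH] a; first by move=> x _; exact: cst_continuous.
split=> [x _|i]; first exact: differentiable_cst.
have -> : pderiv i (fun=> a) = fun=> 0 by apply/funext => x; exact: pderiv_cst.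
exact: IH.
Qed.

Lemma smooth_coord U i : smooth_on U (fun x => x 0 i).
Proof.
have dc (x : 'rV[R]_n) : differentiable (fun x : 'rV[R]_n => x 0 i) x.
  exact: differentiable_coord.
case=> [x _|k]; first exact: differentiable_continuous (dc x).
split=> [x _|j]; first exact: dc.
have -> : pderiv j (fun x : 'rV[R]_n => x 0 i) = fun=> (j == i)%:R.
  by apply/funext => x; exact: pderiv_coord.
exact: smooth_cst.
Qed.

Lemma diff_onD k U f g : open U -> diff_on k U f -> diff_on k U g ->
  diff_on k U (fun x => f x + g x).
Proof.
move=> oU; elim: k f g => [|k IH] f g.
  by move=> cf cg x Ux; exact: cvgD (cf x Ux) (cg x Ux).
move=> [df dpf] [dg dpg]; split=> [x Ux|i].
  by apply: differentiableD; [exact: df|exact: dg].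
apply: eq_diff_on (IH _ _ (dpf i) (dpg i)) => // x Ux.
by rewrite pderivD //; [exact: df|exact: dg].
Qed.

Lemma diff_onM k U f g : open U -> diff_on k U f -> diff_on k U g ->
  diff_on k U (fun x => f x * g x).
Proof.
move=> oU; elim: k f g => [|k IH] f g.
  by move=> cf cg x Ux; exact: cvgM (cf x Ux) (cg x Ux).
move=> Df Dg; have [[df dpf] [dg dpg]] := (Df, Dg); split=> [x Ux|i].
  by apply: differentiableM; [exact: df|exact: dg].
apply: (@eq_diff_on _ _ (fun x => pderiv i f x * g x + f x * pderiv i g x)) => //.
  by move=> x Ux; rewrite pderivM //; [exact: df|exact: dg].
exact: diff_onD oU (IH _ _ (dpf i) (diff_onW Dg)) (IH _ _ (diff_onW Df) (dpg i)).
Qed.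

Lemma smoothD U f g : open U -> smooth_on U f -> smooth_on U g ->
  smooth_on U (fun x => f x + g x).
Proof. by move=> oU sf sg k; apply: diff_onD. Qed.

Lemma smoothM U f g : open U -> smooth_on U f -> smooth_on U g ->
  smooth_on U (fun x => f x * g x).
Proof. by move=> oU sf sg k; apply: diff_onM. Qed.

Lemma smooth_sum U m (F : 'I_m -> 'rV[R]_n -> R) : open U ->
  (forall k, smooth_on U (F k)) -> smooth_on U (fun x => \sum_(k < m) F k x).
Proof.
move=> oU; elim: m F => [|m IH] F sF.
  apply: (@eq_smooth_on _ (fun=> 0)) (smooth_cst _ _) => // x _.
  by rewrite big_ord0.
apply: (@eq_smooth_on _
  (fun x => (\sum_(k < m) F (widen_ord (leqnSn m) k) x) + F ord_max x)) => //.
  by move=> x _; rewrite big_ord_recr.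
by apply: smoothD => //; apply: IH => k.
Qed.

Lemma smooth_map_diff m U (phi : 'rV[R]_n -> 'rV[R]_m) x :
  smooth_map_on U phi -> U x -> differentiable phi x.
Proof.
by move=> sphi Ux; apply: differentiable_rowP => i; exact: smooth_diff (sphi i) Ux.
Qed.

End Smooth.

(** * Symmetry of second partial derivatives *)

Section SecondDerivatives.
Variables (R : realType) (n : nat).
Implicit Types (U : set 'rV[R]_n) (f : 'rV[R]_n -> R) (i j : 'I_n).

Let mean_value (F dF : R -> R) (a : R) : 0 < a ->
  (forall t, 0 <= t <= a -> is_derive t 1 F (dF t)) ->
  exists2 c, 0 < c < a & F a - F 0 = dF c * a.
Proof.
move=> a0 dFP.
have dF1 t : t \in `]0, a[ -> is_derive t 1 F (dF t).
  by rewrite in_itv /= => /andP[t0 ta]; apply: dFP; rewrite !ltW.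
have cF : {within `[0, a], continuous F}.
  apply: derivable_within_continuous => t; rewrite in_itv /= => t0a.
  by have [] := dFP _ t0a.
have [c] := MVT a0 dF1 cF; rewrite in_itv /= subr0 => c0a FE.
by exists c.
Qed.

(** Symmetric in u and v, while the mean value theorem reads it as a mixed
    partial derivative in the order chosen for u and v. *)
Definition second_difference f x (u v : 'rV[R]_n) : R :=
  f (x + u + v) - f (x + u) - f (x + v) + f x.

(** The mean value theorem is applied twice: first along e_i to the increment
    of f in the direction e_j, then along e_j to the i-th partial derivative. *)
Lemma second_differenceE U f x i j a : smooth_on U f -> 0 < a ->
  (forall s t, 0 <= s <= a -> 0 <= t <= a -> U (x + s *: 'e_i + t *: 'e_j)) ->
  exists s t, [/\ 0 <= s <= a, 0 <= t <= a &
    second_difference f x (a *: 'e_i) (a *: 'e_j) =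
    pderiv j (pderiv i f) (x + s *: 'e_i + t *: 'e_j) * (a * a)].
Proof.
move=> sf a0 Ust.
have a0a : 0 <= a <= a by rewrite lexx ltW.
have z0a : 0 <= (0 : R) <= a by rewrite lexx ltW.
have Us s : 0 <= s <= a -> U (x + s *: 'e_i).
  by move=> sa; have := Ust s 0 sa z0a; rewrite scale0r addr0.
pose G s := f (x + a *: 'e_j + s *: 'e_i) - f (x + s *: 'e_i).
have [|s s0a GE] := @mean_value G (fun s => pderiv i f (x + a *: 'e_j + s *: 'e_i) -
    pderiv i f (x + s *: 'e_i)) a a0.
  move=> s s0a; apply: is_deriveB; apply: is_derive_line.
    by apply: smooth_diff sf _; rewrite addrAC; exact: Ust.
  by apply: smooth_diff sf _; exact: Us.
have s0a' : 0 <= s <= a by case/andP: s0a => ? ?; rewrite !ltW.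
have [|t t0a KE] := @mean_value (fun t => pderiv i f (x + s *: 'e_i + t *: 'e_j))
    (fun t => pderiv j (pderiv i f) (x + s *: 'e_i + t *: 'e_j)) a a0.
  move=> t t0a; apply: is_derive_line.
  by apply: (smooth_diff (smooth_pderiv i sf)); exact: Ust.
have t0a' : 0 <= t <= a by case/andP: t0a => ? ?; rewrite !ltW.
exists s, t; split=> //.
transitivity (G a - G 0).
  rewrite /second_difference /G !scale0r !addr0 [x + a *: 'e_j + _]addrAC.
  by rewrite opprB addrA [in RHS]addrAC.
rewrite GE mulrA; congr (_ * a); rewrite addrAC.
by move: KE; rewrite scale0r addr0.
Qed.

(** Schwarz's theorem.  On a small square of side a, the second difference is
    a^2 times a value of either mixed derivative near x; both derivatives are
    continuous at x, so they differ there by less than any e > 0. *)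
Lemma pderivC U f x i j : open U -> smooth_on U f -> U x ->
  pderiv i (pderiv j f) x = pderiv j (pderiv i f) x.
Proof.
move=> oU sf Ux; apply/eqP; rewrite -subr_eq0 -normr_eq0; apply/eqP.
apply/le_anti/andP; split=> //; apply/ler_addgt0Pl => e e0; rewrite addr0.
have e20 : 0 < e / 2 by rewrite divr_gt0.
have near_x k l : \forall y \near x,
    `|pderiv k (pderiv l f) x - pderiv k (pderiv l f) y| < e / 2.
  have : {for x, continuous (pderiv k (pderiv l f))}.
    apply: differentiable_continuous.
    exact: smooth_diff (smooth_pderiv k (smooth_pderiv l sf)) Ux.
  by move=> /cvgrPdist_lt; apply.
have nU : \forall y \near x, U y by exact: open_near oU Ux _.
have : nbhs x (U `&`
  ([set y | `|pderiv i (pderiv j f) x - pderiv i (pderiv j f) y| < e / 2] `&`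
   [set y | `|pderiv j (pderiv i f) x - pderiv j (pderiv i f) y| < e / 2])).
  by apply: filterI => //; apply: filterI; exact: near_x.
move=> /nbhs_ballP[d /= d0 xd].
(* a point of the square of side a at x is within 2 a < d of x *)
pose a := d / 3.
have a0 : 0 < a by rewrite divr_gt0.
have xst s t k l : 0 <= s <= a -> 0 <= t <= a ->
    ball x d (x + s *: 'e_k + t *: 'e_l : 'rV[R]_n).
  move=> /andP[s0 sa] /andP[t0 ta].
  rewrite -ball_normE /ball_ /= -addrA opprD addNKr normrN.
  rewrite (@le_lt_trans _ _ (s + t)) //; last first.
    by rewrite /a in sa ta; lra.
  rewrite (le_trans (ler_normD _ _)) // !normrZ !ger0_norm //.
  have n1 m : `|'e_m : 'rV[R]_n| <= 1.
    rewrite /Num.Def.normr /= mx_normrE; apply: bigmax_le => // pq _ /=.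
    by rewrite mxE normr_nat lern1 leq_b1.
  by apply: lerD; rewrite ler_piMr.
have [s [t [s0a t0a E1]]] : exists s t, [/\ 0 <= s <= a, 0 <= t <= a &
    second_difference f x (a *: 'e_i) (a *: 'e_j) =
    pderiv j (pderiv i f) (x + s *: 'e_i + t *: 'e_j) * (a * a)].
  apply: (second_differenceE sf a0) => s t s0 t0.
  by have [] := xd _ (xst _ _ i j s0 t0).
have [s' [t' [s0a' t0a' E2]]] : exists s t, [/\ 0 <= s <= a, 0 <= t <= a &
    second_difference f x (a *: 'e_j) (a *: 'e_i) =
    pderiv i (pderiv j f) (x + s *: 'e_j + t *: 'e_i) * (a * a)].
  apply: (second_differenceE sf a0) => s' t' s0 t0.
  by have [] := xd _ (xst _ _ j i s0 t0).
have sdC : second_difference f x (a *: 'e_i) (a *: 'e_j) =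
           second_difference f x (a *: 'e_j) (a *: 'e_i).
  rewrite /second_difference [x + a *: 'e_j + _]addrAC; congr (_ + _).
  by rewrite [LHS]addrAC.
have aa0 : a * a != 0 by rewrite mulf_neq0 // gt_eqF.
move: sdC; rewrite E1 E2 => /(mulIf aa0) E.
have [_ [_ B1]] := xd _ (xst _ _ i j s0a t0a).
have [_ [B2 _]] := xd _ (xst _ _ j i s0a' t0a').
set A := pderiv i _ x; set B := pderiv j _ x.
set C := pderiv i (pderiv j f) (x + s' *: 'e_j + t' *: 'e_i) in E B2.
apply: (le_trans (ler_distD C A B)).
rewrite [e]splitr; apply: lerD; first exact: ltW B2.
by rewrite -E distrC; exact: ltW B1.
Qed.

End SecondDerivatives.

(** * Base pullback and total derivative *)

Section TotalDerivative.
Variables (R : realType) (n : nat).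
Implicit Types (U : set 'rV[R]_n) (F G : 'rV[R]_n -> R) (z : 'rV[R]_(n + n)).

(** The complete lift of a function: dF seen as a fibrewise linear function of
    the point z = (x, y) of the tangent space. *)
Definition tdiff F z : R := \sum_(s < n) pderiv s F (lsubmx z) * rsubmx z 0 s.

Definition tdiff_mx p q (A : 'rV[R]_n -> 'M[R]_(p, q)) z : 'M[R]_(p, q) :=
  \matrix_(i, j) tdiff (fun x => A x i j) z.

Lemma open_total U : open U -> open [set z : 'rV[R]_(n + n) | U (lsubmx z)].
Proof.
apply: open_comp => z _; apply: differentiable_continuous.
exact: differentiable_lsubmx.
Qed.

(** The first n coordinates of z are those of the base point, and the last n
    are those of the fibre. *)
Lemma pderiv_base F z (i : 'I_(n + n)) : differentiable F (lsubmx z) ->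
  pderiv i (F \o lsubmx) z =
  if fintype.split i is inl k then pderiv k F (lsubmx z) else 0.
Proof.
move=> dF; rewrite pderiv_comp //; last exact: differentiable_lsubmx.
have E k : pderiv i (fun y : 'rV[R]_(n + n) => (lsubmx y : 'rV_n) 0 k) z =
    (i == lshift n k)%:R.
  rewrite -(pderiv_coord z); congr (pderiv i _ z).
  by apply/funext => y; rewrite mxE.
under eq_bigr do rewrite E.
case: split_ordP => k ->.
  rewrite (bigD1 k) //= eqxx mul1r big1 ?addr0 // => l lk.
  by rewrite eq_lshift eq_sym (negbTE lk) mul0r.
by rewrite big1 // => l _; rewrite eq_rlshift mul0r.
Qed.

Lemma pderiv_lbase F z k : differentiable F (lsubmx z) ->
  pderiv (lshift n k) (F \o lsubmx) z = pderiv k F (lsubmx z).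
Proof. by move=> dF; rewrite pderiv_base // (unsplitK (inl k)). Qed.

Lemma pderiv_rbase F z k : differentiable F (lsubmx z) ->
  pderiv (rshift n k) (F \o lsubmx) z = 0.
Proof. by move=> dF; rewrite pderiv_base // (unsplitK (inr k)). Qed.

Lemma smooth_base U F : open U -> smooth_on U F ->
  smooth_on [set z : 'rV[R]_(n + n) | U (lsubmx z)] (F \o lsubmx).
Proof.
move=> oU sF k; move: (sF k) => {sF}.
elim: k F => [|k IH] F.
  move=> cF z Uz; apply: continuous_comp (cF _ Uz).
  by apply: differentiable_continuous; exact: differentiable_lsubmx.
move=> [dF dpF]; split=> [z Uz|i].
  by apply: differentiable_comp (dF _ Uz); exact: differentiable_lsubmx.
case: (split_ordP i) => j ->.
  apply: eq_diff_on (IH _ (dpF j)); first exact: open_total.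
  by move=> z Uz; rewrite pderiv_lbase //; exact: dF.
apply: (@eq_diff_on _ _ _ _ (fun=> 0)); first exact: open_total.
  by move=> z Uz; rewrite pderiv_rbase //; exact: dF.
exact: smooth_cst.
Qed.

Lemma smooth_tdiff U F : open U -> smooth_on U F ->
  smooth_on [set z : 'rV[R]_(n + n) | U (lsubmx z)] (tdiff F).
Proof.
move=> oU sF; have oT := open_total oU; apply: smooth_sum => // s.
apply: smoothM => //; first exact: (smooth_base oU (smooth_pderiv s sF)).
apply: (@eq_smooth_on _ _ _ (fun z => z 0 (rshift n s))) (smooth_coord _ _) => //.
by move=> z _; rewrite mxE.
Qed.

(** Along the base, d/dx^k sum_s d_sF(x) y^s = sum_s d_k d_sF(x) y^s, which is
    the total derivative of d_kF by the symmetry of second derivatives. *)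
Lemma pderiv_tdiff U F z (i : 'I_(n + n)) : open U -> smooth_on U F ->
  U (lsubmx z) ->
  pderiv i (tdiff F) z =
  match fintype.split i with
  | inl k => tdiff (pderiv k F) z
  | inr k => pderiv k F (lsubmx z)
  end.
Proof.
move=> oU sF Uz.
have dpF s : differentiable (pderiv s F) (lsubmx z).
  exact: smooth_diff (smooth_pderiv s sF) Uz.
have dpFl s : differentiable (pderiv s F \o lsubmx) z.
  by apply: differentiable_comp => //; exact: differentiable_lsubmx.
have cE s : (fun y : 'rV[R]_(n + n) => (rsubmx y : 'rV_n) 0 s) =
            fun y => y 0 (rshift n s).
  by apply/funext => y; rewrite mxE.
have dr s : differentiable (fun y : 'rV[R]_(n + n) => (rsubmx y : 'rV_n) 0 s) z.
  by rewrite cE; exact: differentiable_coord.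
rewrite /tdiff pderiv_sum; last first.
  by move=> s; apply: (differentiableM (dpFl s) (dr s)).
under eq_bigr => s _.
  rewrite (pderivM i (dpFl s) (dr s)) cE pderiv_coord pderiv_base //.
  over.
case: split_ordP => k ->.
  apply: eq_bigr => s _.
  by rewrite eq_lrshift mulr0 addr0 mxE (pderivC _ _ oU sF Uz).
rewrite (bigD1 k) //= eqxx mulr1 mul0r add0r big1 ?addr0 // => s sk.
by rewrite eq_rshift eq_sym (negbTE sk) mulr0 mul0r addr0.
Qed.

Lemma pderiv_ltdiff U F z k : open U -> smooth_on U F -> U (lsubmx z) ->
  pderiv (lshift n k) (tdiff F) z = tdiff (pderiv k F) z.
Proof. by move=> oU sF Uz; rewrite (pderiv_tdiff _ oU sF Uz) (unsplitK (inl k)). Qed.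

Lemma pderiv_rtdiff U F z k : open U -> smooth_on U F -> U (lsubmx z) ->
  pderiv (rshift n k) (tdiff F) z = pderiv k F (lsubmx z).
Proof. by move=> oU sF Uz; rewrite (pderiv_tdiff _ oU sF Uz) (unsplitK (inr k)). Qed.

Lemma near_tdiff F G z : (\forall x \near lsubmx z, F x = G x) ->
  tdiff F z = tdiff G z.
Proof. by move=> FG; apply: eq_bigr => s _; rewrite (near_pderiv _ FG). Qed.

Lemma tdiffD F G z : differentiable F (lsubmx z) -> differentiable G (lsubmx z) ->
  tdiff (fun x => F x + G x) z = tdiff F z + tdiff G z.
Proof.
move=> dF dG; rewrite /tdiff -big_split /=; apply: eq_bigr => s _.
by rewrite pderivD // mulrDl.
Qed.

Lemma tdiffN F z : differentiable F (lsubmx z) ->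
  tdiff (fun x => - F x) z = - tdiff F z.
Proof.
move=> dF; rewrite /tdiff -sumrN; apply: eq_bigr => s _.
by rewrite pderivN // mulNr.
Qed.

Lemma tdiffM F G z : differentiable F (lsubmx z) -> differentiable G (lsubmx z) ->
  tdiff (fun x => F x * G x) z =
  tdiff F z * G (lsubmx z) + F (lsubmx z) * tdiff G z.
Proof.
move=> dF dG; rewrite /tdiff mulr_suml mulr_sumr -big_split /=.
by apply: eq_bigr => s _; rewrite pderivM // mulrDl mulrAC mulrA.
Qed.

Lemma tdiff_sum m (F : 'I_m -> 'rV[R]_n -> R) z :
  (forall k, differentiable (F k) (lsubmx z)) ->
  tdiff (fun x => \sum_(k < m) F k x) z = \sum_(k < m) tdiff (F k) z.
Proof.
move=> dF; rewrite /tdiff exchange_big /=; apply: eq_bigr => s _.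
by rewrite pderiv_sum // mulr_suml.
Qed.

Lemma near_tdiff_mx p q (A B : 'rV[R]_n -> 'M[R]_(p, q)) z :
  (\forall x \near lsubmx z, A x = B x) -> tdiff_mx A z = tdiff_mx B z.
Proof.
move=> AB; apply/matrixP => i j; rewrite !mxE; apply: near_tdiff.
by apply: filterS AB => x ->.
Qed.

Lemma tdiff_trmx p q (A : 'rV[R]_n -> 'M[R]_(p, q)) z :
  tdiff_mx (fun x => (A x)^T) z = (tdiff_mx A z)^T.
Proof.
apply/matrixP => i j; rewrite !mxE; congr (tdiff _ z).
by apply/funext => x; rewrite mxE.
Qed.

Lemma tdiff_mulmx p q r (A : 'rV[R]_n -> 'M[R]_(p, q))
    (B : 'rV[R]_n -> 'M[R]_(q, r)) z :
  (forall i j, differentiable (fun x => A x i j) (lsubmx z)) ->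
  (forall i j, differentiable (fun x => B x i j) (lsubmx z)) ->
  tdiff_mx (fun x => A x *m B x) z =
  tdiff_mx A z *m B (lsubmx z) + A (lsubmx z) *m tdiff_mx B z.
Proof.
move=> dA dB; apply/matrixP => i j; rewrite !mxE -big_split /=.
have -> : (fun x => (A x *m B x) i j) = fun x => \sum_(k < q) A x i k * B x k j.
  by apply/funext => x; rewrite mxE.
rewrite tdiff_sum => [|k]; last exact: (differentiableM (dA i k) (dB k j)).
by apply: eq_bigr => k _; rewrite tdiffM // !mxE.
Qed.

End TotalDerivative.

(** * Tangent maps *)

Section TangentMap.
Variable R : realType.

Definition tangent_map n m (phi : 'rV[R]_n -> 'rV[R]_m) (z : 'rV[R]_(n + n)) :
    'rV[R]_(m + m) :=
  row_mx (phi (lsubmx z)) (tdiff_mx phi z).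

(** The total derivative of a map is its differential applied to y. *)
Lemma tdiff_mxE n m (phi : 'rV[R]_n -> 'rV[R]_m) z :
  differentiable phi (lsubmx z) ->
  tdiff_mx phi z = rsubmx z *m 'J phi (lsubmx z).
Proof.
move=> dphi; apply/rowP => i; rewrite mxE [RHS]mxE; apply: eq_bigr => s _.
by rewrite jacobianE // mulrC.
Qed.

(** Naturality of the total derivative: this is the chain rule. *)
Lemma tdiff_comp n m (phi : 'rV[R]_n -> 'rV[R]_m) (G : 'rV[R]_m -> R) z :
  differentiable phi (lsubmx z) -> differentiable G (phi (lsubmx z)) ->
  tdiff (G \o phi) z = tdiff G (tangent_map phi z).
Proof.
move=> dphi dG; rewrite /tdiff /tangent_map row_mxKl row_mxKr.
under eq_bigr do rewrite pderiv_comp // mulr_suml.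
rewrite exchange_big /=; apply: eq_bigr => k _.
rewrite mxE /tdiff mulr_sumr; apply: eq_bigr => s _.
by rewrite mulrA [pderiv k _ _ * _]mulrC.
Qed.

Lemma smooth_tangent_map n m (U : set 'rV[R]_n) (phi : 'rV[R]_n -> 'rV[R]_m) :
  open U -> smooth_map_on U phi ->
  smooth_map_on [set z : 'rV[R]_(n + n) | U (lsubmx z)] (tangent_map phi).
Proof.
move=> oU sphi i; have oT := open_total oU.
case: (split_ordP i) => j ->.
  apply: eq_smooth_on (smooth_base oU (sphi j)) => // z _.
  by rewrite row_mxEl.
apply: eq_smooth_on (smooth_tdiff oU (sphi j)) => // z _.
by rewrite row_mxEr mxE.
Qed.

(** The off-diagonal block is the total derivative of the Jacobian matrix by
    the symmetry of second derivatives; the zero block says that the base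
    point of the image depends on the base point alone. *)
Lemma jacobian_tangent_map n m (U : set 'rV[R]_n) (phi : 'rV[R]_n -> 'rV[R]_m) z :
  open U -> smooth_map_on U phi -> U (lsubmx z) ->
  'J (tangent_map phi) z =
  block_mx ('J phi (lsubmx z)) (tdiff_mx (jacobian phi) z) 0 ('J phi (lsubmx z)).
Proof.
move=> oU sphi Uz; have dphi := smooth_map_diff sphi Uz.
have dT := smooth_map_diff (smooth_tangent_map oU sphi) Uz.
apply/matrixP => i j; rewrite jacobianE //.
have lE k : (fun y => tangent_map phi y 0 (lshift m k)) =
    (fun x => phi x 0 k) \o lsubmx.
  by apply/funext => y; rewrite row_mxEl.
have rE k : (fun y => tangent_map phi y 0 (rshift m k)) =
    tdiff (fun x => phi x 0 k).
  by apply/funext => y; rewrite row_mxEr mxE.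
have dk k : differentiable (fun x => phi x 0 k) (lsubmx z).
  exact: smooth_diff (sphi k) Uz.
case: (split_ordP i) => i' ->; case: (split_ordP j) => j' ->.
- by rewrite block_mxEul jacobianE // lE pderiv_lbase.
- rewrite block_mxEur mxE rE (pderiv_ltdiff _ oU (sphi j') Uz).
  apply: near_tdiff; apply: (open_near oU Uz) => x Ux.
  by rewrite jacobianE //; exact: smooth_map_diff sphi Ux.
- by rewrite block_mxEdl mxE lE pderiv_rbase.
by rewrite block_mxEdr jacobianE // rE (pderiv_rtdiff _ oU (sphi j') Uz).
Qed.

Lemma near_jacobian n m (phi psi : 'rV[R]_n -> 'rV[R]_m) x :
  (\forall y \near x, phi y = psi y) -> differentiable phi x ->
  'J phi x = 'J psi x.
Proof.
move=> E dphi; have dpsi := near_eq_differentiable E dphi.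
apply/matrixP => i j.
rewrite [LHS]jacobianE // [RHS]jacobianE //; apply: near_pderiv.
by apply: filterS E => y ->.
Qed.

Lemma jacobian_comp n m p (phi : 'rV[R]_n -> 'rV[R]_m)
    (psi : 'rV[R]_m -> 'rV[R]_p) x :
  differentiable phi x -> differentiable psi (phi x) ->
  'J (psi \o phi) x = 'J phi x *m 'J psi (phi x).
Proof.
move=> dphi dpsi; apply/matrixP => i j.
rewrite (jacobianE _ _ (differentiable_comp dphi dpsi)).
rewrite (@pderiv_comp _ _ _ phi (fun y => psi y 0 j)) //; last first.
  exact: (@differentiable_comp _ _ _ _ psi (fun w : 'rV[R]_p => w 0 j) _ dpsi
    (differentiable_coord _ _ _)).
rewrite mxE; apply: eq_bigr => k _.
by congr (_ * _); rewrite jacobianE.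
Qed.

Lemma jacobian_id n (x : 'rV[R]_n) : 'J (@id 'rV[R]_n) x = 1%:M.
Proof.
by apply/matrixP => i j; rewrite jacobianE // pderiv_coord mxE.
Qed.

End TangentMap.

(** * Brackets in coordinates *)

Lemma sum4_rev (R : nzRingType) n (E : 'I_n -> 'I_n -> 'I_n -> 'I_n -> R) :
  \sum_i \sum_l \sum_j \sum_k E i l j k = \sum_i \sum_l \sum_j \sum_k E k j l i.
Proof.
rewrite [RHS]exchange_big /=.
under [RHS]eq_bigr do under eq_bigr do rewrite exchange_big /=.
rewrite [LHS]pair_bigA [RHS]pair_bigA /=.
under eq_bigr do rewrite pair_bigA /=.
under [RHS]eq_bigr do rewrite pair_bigA /=.
exact: exchange_big.
Qed.

Lemma sum3_rev (R : nzRingType) n (E : 'I_n -> 'I_n -> 'I_n -> R) :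
  \sum_i \sum_j \sum_k E i j k = \sum_i \sum_j \sum_k E k j i.
Proof.
rewrite [RHS]exchange_big /= [LHS]exchange_big /=; apply: eq_bigr => j _.
exact: exchange_big.
Qed.

Section LocalBrackets.
Variables (R : realType) (n : nat).
Implicit Types (U : set 'rV[R]_n) (F G H : 'rV[R]_n -> R) (x : 'rV[R]_n).
Implicit Types (P : 'rV[R]_n -> 'M[R]_n) (X : 'rV[R]_n -> 'rV[R]_n).

Definition lbracket P F G x : R :=
  \sum_(i < n) \sum_(j < n) P x i j * pderiv i F x * pderiv j G x.

Definition lapply X F x : R := \sum_(i < n) X x 0 i * pderiv i F x.

Definition jacobiator P i j k x : R :=
  \sum_(l < n) (P x i l * pderiv l (fun y => P y j k) x +
                P x j l * pderiv l (fun y => P y k i) x +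
                P x k l * pderiv l (fun y => P y i j) x).

Definition lie_bivector X P i j x : R :=
  \sum_(l < n) (X x 0 l * pderiv l (fun y => P y i j) x
    - P x l j * pderiv l (fun y => X y 0 i) x
    - P x i l * pderiv l (fun y => X y 0 j) x).

Lemma jacobiator_cycle P i j k x : jacobiator P i j k x = jacobiator P j k i x.
Proof. by apply: eq_bigr => l _; rewrite -addrA addrC. Qed.

Lemma pderiv_lbracket U P F G x l : open U ->
  (forall i j, smooth_on U (fun x => P x i j)) ->
  smooth_on U F -> smooth_on U G -> U x ->
  pderiv l (lbracket P F G) x =
  \sum_(i < n) \sum_(j < n)
    (pderiv l (fun y => P y i j) x * pderiv i F x * pderiv j G x +
     P x i j * pderiv l (pderiv i F) x * pderiv j G x +
     P x i j * pderiv i F x * pderiv l (pderiv j G) x).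
Proof.
move=> oU sP sF sG Ux.
have dP i j : differentiable (fun x => P x i j) x by exact: smooth_diff (sP i j) Ux.
have dF i : differentiable (pderiv i F) x.
  exact: smooth_diff (smooth_pderiv i sF) Ux.
have dG i : differentiable (pderiv i G) x.
  exact: smooth_diff (smooth_pderiv i sG) Ux.
have dPF i j := differentiableM (dP i j) (dF i).
have dPFG i j := differentiableM (dPF i j) (dG j).
rewrite pderiv_sum => [|i]; last first.
  by rewrite -fct_sumE; apply: differentiable_sum => j; exact: dPFG.
apply: eq_bigr => i _; rewrite pderiv_sum => [|j]; last exact: dPFG.
apply: eq_bigr => j _.
by rewrite (pderivM _ (dPF i j) (dG j)) (pderivM _ (dP i j) (dF i)) mulrDl.
Qed.

Lemma pderiv_lapply U X F x l : open U -> smooth_map_on U X ->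
  smooth_on U F -> U x ->
  pderiv l (lapply X F) x =
  \sum_(i < n) (pderiv l (fun y => X y 0 i) x * pderiv i F x +
                X x 0 i * pderiv l (pderiv i F) x).
Proof.
move=> oU sX sF Ux.
have dX i : differentiable (fun x => X x 0 i) x by exact: smooth_diff (sX i) Ux.
have dF i : differentiable (pderiv i F) x.
  exact: smooth_diff (smooth_pderiv i sF) Ux.
rewrite pderiv_sum => [|i]; last exact: (differentiableM (dX i) (dF i)).
by apply: eq_bigr => i _; rewrite (pderivM _ (dX i) (dF i)).
Qed.

(** On the left, X(d_iF) occurs in X{F, G} and, after two derivatives of F
    have been exchanged, in {X(F), G}, with opposite signs; likewise X(d_jG).
    What remains is of first order in F and G. *)
Lemma lie_lbracket U X P F G x : open U ->
  (forall i j, smooth_on U (fun x => P x i j)) -> smooth_map_on U X ->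
  smooth_on U F -> smooth_on U G -> U x ->
  lapply X (lbracket P F G) x - lbracket P (lapply X F) G x
    - lbracket P F (lapply X G) x =
  \sum_(i < n) \sum_(j < n)
    lie_bivector X P i j x * pderiv i F x * pderiv j G x.
Proof.
move=> oU sP sX sF sG Ux.
have -> : lapply X (lbracket P F G) x =
    \sum_(i < n) \sum_(j < n) \sum_(l < n) X x 0 l *
      (pderiv l (fun y => P y i j) x * pderiv i F x * pderiv j G x +
       P x i j * pderiv l (pderiv i F) x * pderiv j G x +
       P x i j * pderiv i F x * pderiv l (pderiv j G) x).
  under [RHS]eq_bigr do rewrite exchange_big /=.
  rewrite [RHS]exchange_big /=; apply: eq_bigr => l _.
  rewrite (pderiv_lbracket _ oU sP sF sG Ux) mulr_sumr.
  by apply: eq_bigr => i _; rewrite mulr_sumr.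
(* both correction terms are reindexed so that the sum over the derivation
   index is innermost *)
have -> : lbracket P (lapply X F) G x =
    \sum_(i < n) \sum_(j < n) \sum_(l < n)
      (P x l j * pderiv l (fun y => X y 0 i) x * pderiv i F x * pderiv j G x +
       P x i j * (X x 0 l * pderiv l (pderiv i F) x) * pderiv j G x).
  transitivity (
    \sum_(i < n) \sum_(j < n) \sum_(l < n)
      P x i j * pderiv i (fun y => X y 0 l) x * pderiv l F x * pderiv j G x +
    \sum_(i < n) \sum_(j < n) \sum_(l < n)
      P x i j * (X x 0 l * pderiv l (pderiv i F) x) * pderiv j G x).
    do 2![rewrite -big_split /=; apply: eq_bigr => ? _].
    rewrite (pderiv_lapply _ oU sX sF Ux) mulr_sumr mulr_suml -big_split /=.
    apply: eq_bigr => l _; rewrite (pderivC l _ oU sF Ux); ring.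
  rewrite [X in X + _]sum3_rev.
  by do 3![rewrite -big_split /=; apply: eq_bigr => ? _].
have -> : lbracket P F (lapply X G) x =
    \sum_(i < n) \sum_(j < n) \sum_(l < n)
      (P x i l * pderiv l (fun y => X y 0 j) x * pderiv i F x * pderiv j G x +
       P x i j * pderiv i F x * (X x 0 l * pderiv l (pderiv j G) x)).
  apply: eq_bigr => i _; transitivity (
    \sum_(j < n) \sum_(l < n)
      P x i j * pderiv j (fun y => X y 0 l) x * pderiv i F x * pderiv l G x +
    \sum_(j < n) \sum_(l < n)
      P x i j * pderiv i F x * (X x 0 l * pderiv l (pderiv j G) x)).
    rewrite -big_split /=; apply: eq_bigr => j _.
    rewrite (pderiv_lapply _ oU sX sG Ux) mulr_sumr -big_split /=.
    apply: eq_bigr => l _; rewrite (pderivC l j oU sG Ux); ring.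
  rewrite [X in X + _]exchange_big /=.
  by do 2![rewrite -big_split /=; apply: eq_bigr => ? _].
rewrite -!sumrB; apply: eq_bigr => i _.
rewrite -!sumrB; apply: eq_bigr => j _.
rewrite -!sumrB /lie_bivector !mulr_suml; apply: eq_bigr => l _.
move: (pderiv l (pderiv i F) x) (pderiv l (pderiv j G) x) (pderiv i F x).
move: (pderiv j G x) (pderiv l (fun y => P y i j) x).
move: (pderiv l (fun y => X y 0 i) x) (pderiv l (fun y => X y 0 j) x).
move: (X x 0 l) (P x i l) (P x l j) (P x i j) => *.
by ring.
Qed.

(** Expanding {F, {G, H}} gives a part T without second derivatives, a part
    A F G H in the second derivatives of G, and, as P is antisymmetric,
    - A F H G for those of H.  By the symmetry of second derivatives, A F G H
    is symmetric in F and H, so these parts cancel in the cyclic sum, and the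
    parts T add up to the jacobiator. *)
Lemma jacobi_lbracket U P F G H x : open U ->
  (forall i j, smooth_on U (fun x => P x i j)) ->
  (forall x i j, U x -> P x i j = - P x j i) ->
  smooth_on U F -> smooth_on U G -> smooth_on U H -> U x ->
  lbracket P F (lbracket P G H) x + lbracket P G (lbracket P H F) x +
    lbracket P H (lbracket P F G) x =
  \sum_(i < n) \sum_(j < n) \sum_(k < n)
    jacobiator P i j k x * pderiv i F x * pderiv j G x * pderiv k H x.
Proof.
move=> oU sP aP sF sG sH Ux.
pose T F G H := \sum_(i < n) \sum_(j < n) \sum_(k < n) \sum_(l < n)
  P x i l * pderiv l (fun y => P y j k) x *
    pderiv i F x * pderiv j G x * pderiv k H x.
pose A F G H := \sum_(i < n) \sum_(l < n) \sum_(j < n) \sum_(k < n)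
  P x i l * pderiv i F x * P x j k * pderiv l (pderiv j G) x * pderiv k H x.
have bE F1 G1 H1 : smooth_on U F1 -> smooth_on U G1 -> smooth_on U H1 ->
    lbracket P F1 (lbracket P G1 H1) x = T F1 G1 H1 + A F1 G1 H1 - A F1 H1 G1.
  move=> sF1 sG1 sH1.
  have -> : T F1 G1 H1 = \sum_(i < n) \sum_(l < n) \sum_(j < n) \sum_(k < n)
      P x i l * pderiv l (fun y => P y j k) x *
      pderiv i F1 x * pderiv j G1 x * pderiv k H1 x.
    apply: eq_bigr => i _; rewrite [RHS]exchange_big /=; apply: eq_bigr => j _.
    by rewrite [RHS]exchange_big.
  rewrite /A -big_split -sumrB /=; apply: eq_bigr => i _.
  rewrite -big_split -sumrB /=; apply: eq_bigr => l _.
  rewrite (pderiv_lbracket _ oU sP sG1 sH1 Ux) mulr_sumr.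
  rewrite [X in _ - X]exchange_big /=.
  rewrite -big_split -sumrB /=; apply: eq_bigr => j _.
  rewrite mulr_sumr -big_split -sumrB /=; apply: eq_bigr => k _.
  rewrite [P x k j]aP //.
  move: (pderiv l (pderiv j G1) x) (pderiv l (pderiv k H1) x).
  move: (pderiv i F1 x) (pderiv j G1 x) (pderiv k H1 x).
  move: (pderiv l (fun y => P y j k) x) => *.
  by ring.
have AC F1 G1 H1 : smooth_on U G1 -> A F1 G1 H1 = A H1 G1 F1.
  move=> sG1; rewrite /A [RHS]sum4_rev.
  apply: eq_bigr => i _; apply: eq_bigr => l _.
  apply: eq_bigr => j _; apply: eq_bigr => k _.
  rewrite (pderivC l j oU sG1 Ux) [P x k j]aP // [P x l i]aP //.
  move: (pderiv j (pderiv l G1) x) (pderiv i F1 x) (pderiv k H1 x) => *.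
  by ring.
(* the cyclic permutations of T, with the sums renamed so that F, G and H
   carry the indices i, j and k again *)
have T2E : T G H F = \sum_(i < n) \sum_(j < n) \sum_(k < n) \sum_(l < n)
    P x j l * pderiv l (fun y => P y k i) x *
    pderiv j G x * pderiv k H x * pderiv i F x.
  by under [LHS]eq_bigr do rewrite exchange_big /=; rewrite [LHS]exchange_big.
have T3E : T H F G = \sum_(i < n) \sum_(j < n) \sum_(k < n) \sum_(l < n)
    P x k l * pderiv l (fun y => P y i j) x *
    pderiv k H x * pderiv i F x * pderiv j G x.
  by rewrite [LHS]exchange_big /=; apply: eq_bigr => i _; rewrite exchange_big.
rewrite (bE _ _ _ sF sG sH) (bE _ _ _ sG sH sF) (bE _ _ _ sH sF sG).
rewrite (AC H G F sG) (AC G F H sF) (AC F H G sH).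
transitivity (T F G H + T G H F + T H F G).
  move: (T F G H) (T G H F) (T H F G) (A F G H) (A G H F) (A H F G) => *.
  by ring.
rewrite T2E T3E /T; do 3![rewrite -!big_split /=; apply: eq_bigr => ? _].
rewrite -!big_split /= /jacobiator !mulr_suml; apply: eq_bigr => l _.
move: (pderiv _ F x) (pderiv _ G x) (pderiv _ H x) => *.
by ring.
Qed.

End LocalBrackets.

(** * Lifted tensors in coordinates *)

Section LiftedIdentities.
Variables (R : realType) (n : nat).
Variables (U : set 'rV[R]_n) (P : 'rV[R]_n -> 'M[R]_n) (X : 'rV[R]_n -> 'rV[R]_n).
Hypothesis oU : open U.
Hypothesis sP : forall i j, smooth_on U (fun x => P x i j).
Hypothesis aP : forall x i j, U x -> P x i j = - P x j i.
Hypothesis sX : smooth_map_on U X.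
Implicit Type z : 'rV[R]_(n + n).

(** The components of [tangent_poisson] in a chart in which the bivector has
    components P; similarly below for X and [vertical_lift]. *)
Definition lift_bivector z : 'M[R]_(n + n) :=
  block_mx 0 (P (lsubmx z)) (- (P (lsubmx z))^T) (tdiff_mx P z).

Definition lift_vertical z : 'rV[R]_(n + n) := row_mx 0 (X (lsubmx z)).

Let T := [set z : 'rV[R]_(n + n) | U (lsubmx z)].
Let oT : open T := open_total oU.

Lemma lift_bivector_ll z i j : lift_bivector z (lshift n i) (lshift n j) = 0.
Proof. by rewrite block_mxEul mxE. Qed.

Lemma lift_bivector_lr z i j :
  lift_bivector z (lshift n i) (rshift n j) = P (lsubmx z) i j.
Proof. by rewrite block_mxEur. Qed.

(** The block - P^T is P itself because P is antisymmetric; this holds on U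
    only, so that derivatives of these entries are computed through equality
    near a point. *)
Lemma lift_bivector_rl z i j : U (lsubmx z) ->
  lift_bivector z (rshift n i) (lshift n j) = P (lsubmx z) i j.
Proof. by move=> Uz; rewrite block_mxEdl !mxE -aP. Qed.

Lemma lift_bivector_rr z i j :
  lift_bivector z (rshift n i) (rshift n j) = tdiff (fun x => P x i j) z.
Proof. by rewrite block_mxEdr mxE. Qed.

Let lift_bivectorE := (lift_bivector_ll, lift_bivector_lr, lift_bivector_rr).

Lemma smooth_lift_bivector i j : smooth_on T (fun z => lift_bivector z i j).
Proof.
case: (split_ordP i) => i' ->; case: (split_ordP j) => j' ->.
- by apply: eq_smooth_on (smooth_cst _ 0) => // z _; rewrite lift_bivectorE.
- apply: eq_smooth_on (smooth_base oU (sP i' j')) => // z _.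
  by rewrite lift_bivectorE.
- apply: eq_smooth_on (smooth_base oU (sP i' j')) => // z Uz.
  by rewrite lift_bivector_rl.
apply: eq_smooth_on (smooth_tdiff oU (sP i' j')) => // z _.
by rewrite lift_bivectorE.
Qed.

Lemma smooth_lift_vertical : smooth_map_on T lift_vertical.
Proof.
move=> i; case: (split_ordP i) => j ->.
  by apply: eq_smooth_on (smooth_cst _ 0) => // z _; rewrite row_mxEl mxE.
by apply: eq_smooth_on (smooth_base oU (sX j)) => // z _; rewrite row_mxEr.
Qed.

Lemma lift_bivector_antisym z : U (lsubmx z) ->
  (lift_bivector z)^T = - lift_bivector z.
Proof.
move=> Uz; rewrite /lift_bivector tr_block_mx opp_block_mx linearN /= trmxK.
rewrite opprK trmx0 oppr0; congr block_mx.
apply/matrixP => i j; rewrite !mxE -tdiffN; last exact: smooth_diff (sP i j) Uz.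
by apply: near_tdiff; apply: (open_near oU Uz) => x Ux; rewrite aP.
Qed.

Section At.
Variable z : 'rV[R]_(n + n).
Hypothesis Uz : U (lsubmx z).

Let dP i j : differentiable (fun x => P x i j) (lsubmx z).
Proof. exact: smooth_diff (sP i j) Uz. Qed.

Let dX i : differentiable (fun x => X x 0 i) (lsubmx z).
Proof. exact: smooth_diff (sX i) Uz. Qed.

Let ddP k i j : differentiable (pderiv k (fun x => P x i j)) (lsubmx z).
Proof. exact: smooth_diff (smooth_pderiv k (sP i j)) Uz. Qed.

Let ddX k i : differentiable (pderiv k (fun x => X x 0 i)) (lsubmx z).
Proof. exact: smooth_diff (smooth_pderiv k (sX i)) Uz. Qed.

Let dll m i j :
  pderiv m (fun z => lift_bivector z (lshift n i) (lshift n j)) z = 0.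
Proof.
rewrite -(pderiv_cst 0 z m); congr (pderiv m _ z).
by apply/funext => w; rewrite lift_bivectorE.
Qed.

Let lrE i j : (fun z => lift_bivector z (lshift n i) (rshift n j)) =
  (fun x => P x i j) \o lsubmx.
Proof. by apply/funext => w; rewrite lift_bivectorE. Qed.

Let rrE i j : (fun z => lift_bivector z (rshift n i) (rshift n j)) =
  tdiff (fun x => P x i j).
Proof. by apply/funext => w; rewrite lift_bivectorE. Qed.

Let near_rl i j : \forall w \near z,
  lift_bivector w (rshift n i) (lshift n j) = ((fun x => P x i j) \o lsubmx) w.
Proof. by apply: (open_near oT Uz) => w Uw; rewrite lift_bivector_rl. Qed.

Let dlr_l k i j :
  pderiv (lshift n k) (fun z => lift_bivector z (lshift n i) (rshift n j)) z =
  pderiv k (fun x => P x i j) (lsubmx z).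
Proof. by rewrite lrE pderiv_lbase. Qed.

Let dlr_r k i j :
  pderiv (rshift n k) (fun z => lift_bivector z (lshift n i) (rshift n j)) z = 0.
Proof. by rewrite lrE pderiv_rbase. Qed.

Let drl_l k i j :
  pderiv (lshift n k) (fun z => lift_bivector z (rshift n i) (lshift n j)) z =
  pderiv k (fun x => P x i j) (lsubmx z).
Proof. by rewrite (near_pderiv _ (near_rl i j)) pderiv_lbase. Qed.

Let drl_r k i j :
  pderiv (rshift n k) (fun z => lift_bivector z (rshift n i) (lshift n j)) z = 0.
Proof. by rewrite (near_pderiv _ (near_rl i j)) pderiv_rbase. Qed.

Let drr_l k i j :
  pderiv (lshift n k) (fun z => lift_bivector z (rshift n i) (rshift n j)) z =
  tdiff (pderiv k (fun x => P x i j)) z.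
Proof. by rewrite rrE (pderiv_ltdiff _ oU (sP i j) Uz). Qed.

Let drr_r k i j :
  pderiv (rshift n k) (fun z => lift_bivector z (rshift n i) (rshift n j)) z =
  pderiv k (fun x => P x i j) (lsubmx z).
Proof. by rewrite rrE (pderiv_rtdiff _ oU (sP i j) Uz). Qed.

Let dliftE := (dll, dlr_l, dlr_r, drl_l, drl_r, drr_l, drr_r).
Let rlE i j := @lift_bivector_rl z i j Uz.

Let simp := (mul0r, mulr0, oppr0, add0r, addr0).

Let jacobiator_lll i j k :
  jacobiator lift_bivector (lshift n i) (lshift n j) (lshift n k) z = 0.
Proof.
by rewrite /jacobiator big1 // => m _; rewrite !dll !simp.
Qed.

Let jacobiator_llr i j k :
  jacobiator lift_bivector (lshift n i) (lshift n j) (rshift n k) z = 0.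
Proof.
rewrite /jacobiator big_split_ord /= -big_split /= big1 // => m _.
by rewrite !lift_bivectorE !dliftE !simp.
Qed.

Let jacobiator_lrr i j k :
  jacobiator lift_bivector (lshift n i) (rshift n j) (rshift n k) z =
  jacobiator P i j k (lsubmx z).
Proof.
rewrite /jacobiator big_split_ord /= -big_split /=; apply: eq_bigr => m _.
rewrite !lift_bivectorE !rlE !dliftE !simp.
by rewrite addrC addrA.
Qed.

Let jacobiator_rrr i j k :
  jacobiator lift_bivector (rshift n i) (rshift n j) (rshift n k) z =
  tdiff (jacobiator P i j k) z.
Proof.
have dM i' j' k' l := differentiableM (dP i' l) (ddP l j' k').
rewrite /jacobiator big_split_ord /= -big_split /= tdiff_sum => [|l]; last first.
  apply: (differentiableD (differentiableD (dM _ _ _ _) (dM _ _ _ _))).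
  exact: dM.
apply: eq_bigr => m _; rewrite !lift_bivectorE !rlE !dliftE.
have dMD := differentiableD (dM i j k m) (dM j k i m).
rewrite (tdiffD dMD (dM k i j m)) (tdiffD (dM i j k m) (dM j k i m)).
rewrite !tdiffM //.
set a1 := tdiff (pderiv _ _) z; set a2 := tdiff (pderiv _ _) z.
set a3 := tdiff (pderiv _ _) z.
move: (pderiv m _ _) (pderiv m _ _) (pderiv m _ _) a1 a2 a3 => *.
by ring.
Qed.

(** The jacobiator is invariant under cyclic permutations of its indices, so
    only the number of fibre indices matters: with at most one it vanishes
    identically, with two it is the jacobiator of P, and with three it is the
    total derivative of the jacobiator of P. *)
Lemma jacobiator_lift a b c :
  (forall x, U x -> forall i j k, jacobiator P i j k x = 0) ->
  jacobiator lift_bivector a b c z = 0.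
Proof.
move=> jP.
have t0 i j k : tdiff (jacobiator P i j k) z = 0.
  rewrite (@near_tdiff _ _ _ (fun=> 0)); last first.
    by apply: (open_near oU Uz) => x Ux; exact: jP.
  by rewrite /tdiff big1 // => s _; rewrite pderiv_cst mul0r.
case: (split_ordP a) => i ->; case: (split_ordP b) => j ->;
  case: (split_ordP c) => k ->.
- exact: jacobiator_lll.
- exact: jacobiator_llr.
- by rewrite 2!jacobiator_cycle jacobiator_llr.
- by rewrite jacobiator_lrr jP.
- by rewrite jacobiator_cycle jacobiator_llr.
- by rewrite jacobiator_cycle jacobiator_lrr jP.
- by rewrite 2!jacobiator_cycle jacobiator_lrr jP.
- by rewrite jacobiator_rrr t0.
Qed.

Let XlE i : (fun z => tangent_map X z 0 (lshift n i)) =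
  (fun x => X x 0 i) \o lsubmx.
Proof. by apply/funext => w; rewrite row_mxEl. Qed.

Let XrE i : (fun z => tangent_map X z 0 (rshift n i)) = tdiff (fun x => X x 0 i).
Proof. by apply/funext => w; rewrite row_mxEr mxE. Qed.

Let dXl_l k i : pderiv (lshift n k) (fun z => tangent_map X z 0 (lshift n i)) z =
  pderiv k (fun x => X x 0 i) (lsubmx z).
Proof. by rewrite XlE pderiv_lbase. Qed.

Let dXl_r k i : pderiv (rshift n k) (fun z => tangent_map X z 0 (lshift n i)) z = 0.
Proof. by rewrite XlE pderiv_rbase. Qed.

Let dXr_l k i : pderiv (lshift n k) (fun z => tangent_map X z 0 (rshift n i)) z =
  tdiff (pderiv k (fun x => X x 0 i)) z.
Proof. by rewrite XrE (pderiv_ltdiff _ oU (sX i) Uz). Qed.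

Let dXr_r k i : pderiv (rshift n k) (fun z => tangent_map X z 0 (rshift n i)) z =
  pderiv k (fun x => X x 0 i) (lsubmx z).
Proof. by rewrite XrE (pderiv_rtdiff _ oU (sX i) Uz). Qed.

Let dXE := (dXl_l, dXl_r, dXr_l, dXr_r).

Let Xl i : tangent_map X z 0 (lshift n i) = X (lsubmx z) 0 i.
Proof. by rewrite row_mxEl. Qed.

Let Xr i : tangent_map X z 0 (rshift n i) = tdiff (fun x => X x 0 i) z.
Proof. by rewrite row_mxEr mxE. Qed.

Let VlE i : (fun z => lift_vertical z 0 (lshift n i)) = fun=> 0.
Proof. by apply/funext => w; rewrite row_mxEl mxE. Qed.

Let VrE i : (fun z => lift_vertical z 0 (rshift n i)) =
  (fun x => X x 0 i) \o lsubmx.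
Proof. by apply/funext => w; rewrite row_mxEr. Qed.

Let dVl k i : pderiv k (fun z => lift_vertical z 0 (lshift n i)) z = 0.
Proof. by rewrite VlE pderiv_cst. Qed.

Let dVr_l k i : pderiv (lshift n k) (fun z => lift_vertical z 0 (rshift n i)) z =
  pderiv k (fun x => X x 0 i) (lsubmx z).
Proof. by rewrite VrE pderiv_lbase. Qed.

Let dVr_r k i : pderiv (rshift n k) (fun z => lift_vertical z 0 (rshift n i)) z = 0.
Proof. by rewrite VrE pderiv_rbase. Qed.

Let dVE := (dVl, dVr_l, dVr_r).

Let Vl i : lift_vertical z 0 (lshift n i) = 0.
Proof. by rewrite row_mxEl mxE. Qed.

Let Vr i : lift_vertical z 0 (rshift n i) = X (lsubmx z) 0 i.
Proof. by rewrite row_mxEr. Qed.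

(** The base-base component vanishes identically, the mixed ones are those of
    the Lie derivative of P along X, and the fibre-fibre ones are their total
    derivatives. *)
Lemma lie_bivector_complete a b :
  (forall x, U x -> forall i j, lie_bivector X P i j x = 0) ->
  lie_bivector (tangent_map X) lift_bivector a b z = 0.
Proof.
move=> lP.
have t0 i j : tdiff (lie_bivector X P i j) z = 0.
  rewrite (@near_tdiff _ _ _ (fun=> 0)); last first.
    by apply: (open_near oU Uz) => x Ux; exact: lP.
  by rewrite /tdiff big1 // => s _; rewrite pderiv_cst mul0r.
case: (split_ordP a) => i ->; case: (split_ordP b) => j ->.
- rewrite /lie_bivector big_split_ord /= -big_split /= big1 // => m _.
  by rewrite !lift_bivectorE !dXE !dliftE !simp.
- rewrite -[RHS](lP _ Uz i j) /lie_bivector big_split_ord /= -big_split /=.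
  apply: eq_bigr => m _.
  by rewrite !lift_bivectorE Xl !dXE !dliftE !simp.
- rewrite -[RHS](lP _ Uz i j) /lie_bivector big_split_ord /= -big_split /=.
  apply: eq_bigr => m _.
  by rewrite !lift_bivectorE !rlE Xl !dXE !dliftE !simp addrAC.
rewrite -[RHS](t0 i j) /lie_bivector big_split_ord /= -big_split /=.
have dM1 m := differentiableM (dX m) (ddP m i j).
have dM2 m := differentiableM (dP m j) (ddX m i).
have dM3 m := differentiableM (dP i m) (ddX m j).
have dN2 m := differentiableN (dM2 m).
have dN3 m := differentiableN (dM3 m).
have dD m := differentiableD (dM1 m) (dN2 m).
rewrite tdiff_sum => [|m]; last exact: (differentiableD (dD m) (dN3 m)).
apply: eq_bigr => m _; rewrite (tdiffD (dD m) (dN3 m)).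
rewrite (tdiffD (dM1 m) (dN2 m)) (tdiffN (dM2 m)) (tdiffN (dM3 m)).
rewrite !tdiffM // !lift_bivectorE !rlE Xl Xr !dXE !dliftE.
set a1 := tdiff (pderiv _ _) z; set a2 := tdiff (pderiv _ _) z.
set a3 := tdiff (pderiv _ _) z.
move: (pderiv m _ _) (pderiv m _ _) (pderiv m _ _) a1 a2 a3 => *.
by ring.
Qed.

(** The fibre-fibre components are those of the Lie derivative of P along X;
    the others vanish identically. *)
Lemma lie_bivector_vertical a b :
  (forall x, U x -> forall i j, lie_bivector X P i j x = 0) ->
  lie_bivector lift_vertical lift_bivector a b z = 0.
Proof.
move=> lP.
case: (split_ordP a) => i ->; case: (split_ordP b) => j ->.
- by rewrite /lie_bivector big1 // => m _; rewrite !dVE !dliftE !simp.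
- rewrite /lie_bivector big_split_ord /= -big_split /= big1 // => m _.
  by rewrite !lift_bivectorE ?Vl !dVE !dliftE !simp.
- rewrite /lie_bivector big_split_ord /= -big_split /= big1 // => m _.
  by rewrite !lift_bivectorE ?Vl !dVE !dliftE !simp.
rewrite -[RHS](lP _ Uz i j) /lie_bivector big_split_ord /= -big_split /=.
apply: eq_bigr => m _.
rewrite !lift_bivectorE !rlE Vl Vr !dVE !dliftE !simp.
by rewrite addrC addrA.
Qed.

End At.

End LiftedIdentities.

(** * Lifts under a change of coordinates *)

Lemma antisym_entry (R : nzRingType) n (A : 'M[R]_n) i j :
  A^T = - A -> A i j = - A j i.
Proof. by move=> /matrixP /(_ j i); rewrite !mxE. Qed.

Section LiftedTransformation.
Variables (R : realType) (n : nat) (O U' : set 'rV[R]_n) (phi : 'rV[R]_n -> 'rV[R]_n).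
Hypothesis oO : open O.
Hypothesis sphi : smooth_map_on O phi.
Hypothesis phiO : forall x, O x -> U' (phi x).

Lemma smooth_jacobian i j : smooth_on O (fun x => 'J phi x i j).
Proof.
apply: eq_smooth_on (smooth_pderiv i (sphi j)) => // x Ox.
by rewrite jacobianE //; exact: smooth_map_diff sphi Ox.
Qed.

Lemma tdiff_mx_comp p q (A : 'rV[R]_n -> 'M[R]_(p, q)) z :
  (forall i j, smooth_on U' (fun x => A x i j)) -> O (lsubmx z) ->
  tdiff_mx (A \o phi) z = tdiff_mx A (tangent_map phi z).
Proof.
move=> sA Oz; apply/matrixP => i j; rewrite !mxE.
rewrite -tdiff_comp //; first exact: smooth_map_diff sphi Oz.
exact: smooth_diff (sA i j) (phiO Oz).
Qed.

(** Block multiplication with the Jacobian matrix of the tangent map: the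
    fibre-fibre block is the Leibniz rule for the total derivative of
    J^T P J, and the other blocks are the transformation law of P. *)
Lemma lift_bivector_transform (P P' : 'rV[R]_n -> 'M[R]_n) z :
  (forall i j, smooth_on O (fun x => P x i j)) ->
  (forall i j, smooth_on U' (fun x => P' x i j)) ->
  (forall x, O x -> (P x)^T = - P x) ->
  (forall x, O x -> P' (phi x) = ('J phi x)^T *m P x *m 'J phi x) ->
  O (lsubmx z) ->
  lift_bivector P' (tangent_map phi z) =
  ('J (tangent_map phi) z)^T *m lift_bivector P z *m 'J (tangent_map phi) z.
Proof.
move=> sP sP' aP PP' Oz.
have dP i j : differentiable (fun x => P x i j) (lsubmx z).
  exact: smooth_diff (sP i j) Oz.
have dJ i j : differentiable (fun x => 'J phi x i j) (lsubmx z).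
  exact: smooth_diff (smooth_jacobian i j) Oz.
have dJT i j : differentiable (fun x => ('J phi x)^T i j) (lsubmx z).
  by under eq_fun do rewrite mxE.
have dJP i j : differentiable (fun x => (('J phi x)^T *m P x) i j) (lsubmx z).
  have -> : (fun x => (('J phi x)^T *m P x) i j) =
      fun x => \sum_(k < n) ('J phi x)^T i k * P x k j.
    by apply/funext => x; rewrite mxE.
  rewrite -fct_sumE; apply: differentiable_sum => k.
  exact: (differentiableM (dJT i k) (dP k j)).
rewrite /lift_bivector [lsubmx (tangent_map _ _)]row_mxKl PP' //.
rewrite -tdiff_mx_comp //.
rewrite (@near_tdiff_mx _ _ _ _ _ (fun x => ('J phi x)^T *m P x *m 'J phi x));
  last by apply: (open_near oO Oz) => x Ox; exact: PP'.
rewrite (tdiff_mulmx dJP dJ) (tdiff_mulmx dJT dP) tdiff_trmx.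
rewrite (jacobian_tangent_map oO sphi Oz) tr_block_mx !mulmx_block trmx0.
rewrite !(mul0mx, mulmx0, add0r, addr0) !trmx_mul trmxK aP // !opprK.
congr block_mx; first by rewrite mulNmx mulmxN opprK mulmxA.
by rewrite addrC.
Qed.

(** For the complete lift, the fibre part is the total derivative of the
    transformation law X' o phi = X J. *)
Lemma lift_vector_transform (X X' : 'rV[R]_n -> 'rV[R]_n) z :
  smooth_map_on O X -> smooth_map_on U' X' ->
  (forall x, O x -> X' (phi x) = X x *m 'J phi x) -> O (lsubmx z) ->
  tangent_map X' (tangent_map phi z) =
    tangent_map X z *m 'J (tangent_map phi) z /\
  lift_vertical X' (tangent_map phi z) =
    lift_vertical X z *m 'J (tangent_map phi) z.
Proof.
move=> sX sX' XX' Oz.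
have dX (i : 'I_1) j : differentiable (fun x => X x i j) (lsubmx z).
  by rewrite (ord1 i); exact: smooth_diff (sX j) Oz.
have dJ i j : differentiable (fun x => 'J phi x i j) (lsubmx z).
  exact: smooth_diff (smooth_jacobian i j) Oz.
have sX1 (i : 'I_1) j : smooth_on U' (fun x => X' x i j) by rewrite (ord1 i).
rewrite /lift_vertical /tangent_map !row_mxKl XX' // (jacobian_tangent_map oO sphi Oz).
rewrite !mul_row_block !(mul0mx, mulmx0, add0r, addr0); split=> //.
rewrite -[row_mx (phi _) _]/(tangent_map phi z) -tdiff_mx_comp //.
rewrite (@near_tdiff_mx _ _ _ _ _ (fun x => X x *m 'J phi x));
  last by apply: (open_near oO Oz) => x Ox; exact: XX'.
by rewrite tdiff_mulmx // addrC.
Qed.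

End LiftedTransformation.

(** * Charts *)

Section Charts.
Variables (R : realType) (n : nat) (M : atlas R n).
Hypothesis paramK : forall c p, dom M c p -> param M c (chart M c p) = p.
Hypothesis overlapP : forall c d : Defs.index M,
  open (overlap c d) /\ smooth_map_on (overlap c d) (transition c d).
Implicit Types (a b c d : Defs.index M) (p : Defs.point M) (x : 'rV[R]_n).

Lemma open_chart_dom c : open (chart M c @` dom M c).
Proof. by have [] := overlapP c c; rewrite /overlap setIid. Qed.

Lemma open_in_dom c : open_in (dom M c).
Proof. by move=> d; rewrite setIC; have [] := overlapP d c. Qed.

Lemma chartK c x : (chart M c @` dom M c) x -> chart M c (param M c x) = x.
Proof. by move=> [p cp <-]; rewrite paramK. Qed.

Lemma transition_chart c d p : dom M c p ->
  transition c d (chart M c p) = chart M d p.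
Proof. by move=> cp; rewrite /transition paramK. Qed.

Lemma overlap_chart c d p : dom M c p -> dom M d p -> overlap c d (chart M c p).
Proof. by move=> cp dp; exists p. Qed.

Lemma transition_diff c d p : dom M c p -> dom M d p ->
  differentiable (transition c d) (chart M c p).
Proof.
move=> cp dp; apply: smooth_map_diff (overlapP c d).2 _.
exact: overlap_chart.
Qed.

(** The cocycle identity for the differentials of the coordinate changes.  The
    transitions themselves compose correctly only near the point, namely on
    the image of the common domain of the three charts. *)
Lemma jacobian_transition_comp a b c p : dom M a p -> dom M b p -> dom M c p ->
  'J (transition a b) (chart M a p) *m 'J (transition b c) (chart M b p) =
  'J (transition a c) (chart M a p).
Proof.
move=> ap bp cp.
have dab := transition_diff ap bp.
have dbc : differentiable (transition b c) (transition a b (chart M a p)).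
  by rewrite transition_chart //; exact: transition_diff.
transitivity ('J (transition b c \o transition a b) (chart M a p)).
  by rewrite (jacobian_comp dab dbc) transition_chart.
apply: near_jacobian; last exact: differentiable_comp dab dbc.
apply: (open_near (overlapP a b).1 (overlap_chart ap bp)) => _ [q [aq bq] <-].
by rewrite /= !transition_chart.
Qed.

Lemma jacobian_transition_id a p : dom M a p ->
  'J (transition a a) (chart M a p) = 1%:M.
Proof.
move=> ap; rewrite -(jacobian_id (chart M a p)); apply: near_jacobian.
  apply: (open_near (overlapP a a).1 (overlap_chart ap ap)) => _ [q [aq _] <-].
  by rewrite transition_chart.
exact: transition_diff.
Qed.

(** Charts are continuous for the topology of the manifold: read in another
    chart, the preimage of O is its preimage under a transition map. *)
Lemma open_in_chart_preimage c (O : set 'rV[R]_n) : open O ->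
  open_in (fun p => dom M c p /\ O (chart M c p)).
Proof.
move=> oO d.
have -> : chart M d @` ((fun p => dom M c p /\ O (chart M c p)) `&` dom M d) =
    overlap d c `&` transition d c @^-1` O.
  apply/seteqP; split=> [_ [p [[cp Op] dp] <-]|_ [[p [dp cp] <-]]].
    by split; [exact: overlap_chart|rewrite /= transition_chart].
  by rewrite /= transition_chart // => Op; exists p.
rewrite openE => x [dcx Ox]; apply: filterI.
  by apply: open_nbhs_nbhs; split=> //; exact: (overlapP d c).1.
have : {for x, continuous (transition d c)}.
  apply: differentiable_continuous.
  exact: smooth_map_diff (overlapP d c).2 dcx.
by apply; apply: open_nbhs_nbhs.
Qed.

Lemma separate_in_chart c p q : dom M c p -> dom M c q -> p <> q ->
  exists V W : set (Defs.point M),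
    [/\ open_in V, open_in W, V p, W q & V `&` W = set0].
Proof.
move=> cp cq pq.
have /eqP cpq : chart M c p <> chart M c q.
  by move=> E; apply: pq; rewrite -(paramK cp) E paramK.
have : hausdorff_space 'rV[R]_n by exact: norm_hausdorff.
rewrite open_hausdorff => /(_ _ _ cpq)[[A B] /=].
move=> [/set_mem Ap /set_mem Bq] [oA oB /eqP AB].
exists (fun p => dom M c p /\ A (chart M c p)),
  (fun p => dom M c p /\ B (chart M c p)); split.
- exact: open_in_chart_preimage.
- exact: open_in_chart_preimage.
- by [].
- by [].
apply/seteqP; split=> // r [[_ Ar] [_ Br]].
by have : (A `&` B) (chart M c r) by []; rewrite AB.
Qed.

Lemma smooth_fun_coord c i : smooth_fun (dom M c) (fun p => chart M c p 0 i).
Proof.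
move=> d; rewrite setIC.
exact: ((overlapP d c).2 i).
Qed.

End Charts.

Lemma manifold_paramK (R : realType) (n : nat) (M : atlas R n) : manifold M ->
  forall c p, dom M c p -> param M c (chart M c p) = p.
Proof. by case. Qed.

Lemma manifold_overlap (R : realType) (n : nat) (M : atlas R n) : manifold M ->
  forall c d : Defs.index M,
    open (overlap c d) /\ smooth_map_on (overlap c d) (transition c d).
Proof. by case. Qed.

Arguments open_chart_dom {R n M} overlapP c.
Arguments open_in_dom {R n M} overlapP c.
Arguments smooth_fun_coord {R n M} overlapP c i.

(** * Poisson conditions as component identities *)

Section PoissonInCharts.
Variables (R : realType) (n : nat) (M : atlas R n).
Hypothesis hM : manifold M.
Implicit Types (c d : Defs.index M) (p : Defs.point M) (f g h : Defs.point M -> R).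
Implicit Types (P : bcomponents M) (X : vcomponents M).

Let paramK := manifold_paramK hM.
Let overlapP := manifold_overlap hM.

Lemma bracket_param P c f g x : (chart M c @` dom M c) x ->
  bracket P c f g (param M c x) =
  lbracket (P c) (f \o param M c) (g \o param M c) x.
Proof. by move=> cx; rewrite /bracket /coord_deriv (chartK paramK cx). Qed.

Lemma vf_apply_param X c f x : (chart M c @` dom M c) x ->
  vf_apply X c f (param M c x) = lapply (X c) (f \o param M c) x.
Proof. by move=> cx; rewrite /vf_apply /coord_deriv (chartK paramK cx). Qed.

(** The bracket only involves f and g near the point, hence only their
    expressions in the chart. *)
Lemma eq_bracket P c f g F G x : (chart M c @` dom M c) x ->
  (forall y, (chart M c @` dom M c) y -> f (param M c y) = F y) ->
  (forall y, (chart M c @` dom M c) y -> g (param M c y) = G y) ->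
  bracket P c f g (param M c x) = lbracket (P c) F G x.
Proof.
move=> cx fF gG; rewrite bracket_param //.
have oc := open_chart_dom overlapP c.
apply: eq_bigr => i _; apply: eq_bigr => j _.
congr (_ * _ * _); apply: near_pderiv; exact: (open_near oc cx).
Qed.

Lemma eq_vf_apply X c f F x : (chart M c @` dom M c) x ->
  (forall y, (chart M c @` dom M c) y -> f (param M c y) = F y) ->
  vf_apply X c f (param M c x) = lapply (X c) F x.
Proof.
move=> cx fF; rewrite vf_apply_param //.
have oc := open_chart_dom overlapP c.
apply: eq_bigr => i _; congr (_ * _); apply: near_pderiv.
exact: (open_near oc cx).
Qed.

Let coord c i : Defs.point M -> R := fun p => chart M c p 0 i.

Let pderiv_coord_param c i k x : (chart M c @` dom M c) x ->
  pderiv k (coord c i \o param M c) x = (k == i)%:R.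
Proof.
move=> cx; rewrite -(pderiv_coord x); apply: near_pderiv.
apply: (open_near (open_chart_dom overlapP c) cx) => y cy.
by rewrite /= /coord (chartK paramK cy).
Qed.

Let smooth_coord_param c i :
  smooth_on (chart M c @` dom M c) (coord c i \o param M c).
Proof. by have := smooth_fun_coord overlapP c i; move/(_ c); rewrite setIid. Qed.

Let sum_delta (E : 'I_n -> R) (i : 'I_n) : \sum_k E k * (k == i)%:R = E i.
Proof.
rewrite (bigD1 i) //= eqxx mulr1 big1 ?addr0 // => k ki.
by rewrite (negbTE ki) mulr0.
Qed.

(** Testing the Jacobi identity on the coordinate functions of a chart, which
    are smooth on its domain only, isolates one component of the jacobiator;
    conversely the Jacobi expression is a combination of these components. *)
Lemma jacobiP P : bivector_field P ->
  jacobi P <-> forall c x, (chart M c @` dom M c) x ->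
    forall i j k, jacobiator (P c) i j k x = 0.
Proof.
move=> [sP aP _].
have aP' c x i j : (chart M c @` dom M c) x -> P c x i j = - P c x j i.
  by move=> cx; exact: antisym_entry (aP c x cx).
have brE c W (f g h : Defs.point M -> R) p : open_in W ->
    smooth_on (chart M c @` (W `&` dom M c)) (f \o param M c) ->
    smooth_on (chart M c @` (W `&` dom M c)) (g \o param M c) ->
    smooth_on (chart M c @` (W `&` dom M c)) (h \o param M c) ->
    W p -> dom M c p ->
    bracket P c f (bracket P c g h) p + bracket P c g (bracket P c h f) p +
      bracket P c h (bracket P c f g) p =
    \sum_i \sum_j \sum_k jacobiator (P c) i j k (chart M c p) *
      pderiv i (f \o param M c) (chart M c p) *
      pderiv j (g \o param M c) (chart M c p) *
      pderiv k (h \o param M c) (chart M c p).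
  move=> oW sf sg sh Wp cp.
  have sub : chart M c @` (W `&` dom M c) `<=` chart M c @` dom M c.
    by move=> _ [q [_ cq] <-]; exists q.
  have cx : (chart M c @` dom M c) (chart M c p) by exists p.
  have E f1 g1 h1 : bracket P c f1 (bracket P c g1 h1) p =
      lbracket (P c) (f1 \o param M c)
        (lbracket (P c) (g1 \o param M c) (h1 \o param M c)) (chart M c p).
    rewrite -{1}(paramK cp); apply: eq_bracket => // y cy.
    exact: bracket_param.
  rewrite !E; apply: (@jacobi_lbracket _ _ (chart M c @` (W `&` dom M c))) => //.
  - by move=> i j; apply: sub_smooth_on sub (sP c i j).
  - by move=> x i j /sub; exact: aP'.
  - by exists p.
split=> [jP c _ [p cp <-] i j k|jP W oW f g h sf sg sh c p Wp cp]; last first.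
  rewrite (brE c W) //.
  by do 3![rewrite big1 // => ? _]; rewrite jP ?mul0r //; exists p.
have cx : (chart M c @` dom M c) (chart M c p) by exists p.
have := jP _ (open_in_dom overlapP c) _ _ _ (smooth_fun_coord overlapP c i)
  (smooth_fun_coord overlapP c j) (smooth_fun_coord overlapP c k) c p cp cp.
rewrite (brE c (dom M c)) ?setIid //; [|exact: open_in_dom overlapP c
  |exact: smooth_coord_param..].
under eq_bigr => a _ do under eq_bigr => b _ do under eq_bigr => e _ do
  rewrite !pderiv_coord_param //.
under eq_bigr => a _ do under eq_bigr => b _ do rewrite sum_delta.
by under eq_bigr => a _ do rewrite sum_delta; rewrite sum_delta.
Qed.

(** As for the Jacobi identity, one direction is obtained by testing on the
    coordinate functions of a chart. *)
Lemma poisson_vector_fieldP P X : bivector_field P -> vector_field X ->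
  poisson_vector_field P X <-> forall c x, (chart M c @` dom M c) x ->
    forall i j, lie_bivector (X c) (P c) i j x = 0.
Proof.
move=> [sP _ _] vX; have [sX _] := vX.
have lieE c W (f g : Defs.point M -> R) p : open_in W ->
    smooth_on (chart M c @` (W `&` dom M c)) (f \o param M c) ->
    smooth_on (chart M c @` (W `&` dom M c)) (g \o param M c) ->
    W p -> dom M c p ->
    vf_apply X c (bracket P c f g) p - bracket P c (vf_apply X c f) g p
      - bracket P c f (vf_apply X c g) p =
    \sum_i \sum_j lie_bivector (X c) (P c) i j (chart M c p) *
      pderiv i (f \o param M c) (chart M c p) *
      pderiv j (g \o param M c) (chart M c p).
  move=> oW sf sg Wp cp.
  have sub : chart M c @` (W `&` dom M c) `<=` chart M c @` dom M c.
    by move=> _ [q [_ cq] <-]; exists q.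
  have cx : (chart M c @` dom M c) (chart M c p) by exists p.
  rewrite -[in LHS](paramK cp).
  rewrite (eq_vf_apply X cx (fun y => @bracket_param P c f g y)).
  rewrite (eq_bracket P cx (fun y => @vf_apply_param X c f y) (fun y _ => erefl)).
  rewrite (eq_bracket P cx (fun y _ => erefl) (fun y => @vf_apply_param X c g y)).
  apply: (@lie_lbracket _ _ (chart M c @` (W `&` dom M c))) => //.
  - by move=> i j; apply: sub_smooth_on sub (sP c i j).
  - by move=> i; apply: sub_smooth_on sub (sX c i).
  - by exists p.
split=> [[_ pX] c _ [p cp <-] i j|lX]; last first.
  split=> // W oW f g sf sg c p Wp cp; rewrite (lieE c W) //.
  by do 2![rewrite big1 // => ? _]; rewrite lX ?mul0r //; exists p.
have cx : (chart M c @` dom M c) (chart M c p) by exists p.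
have := pX _ (open_in_dom overlapP c) _ _ (smooth_fun_coord overlapP c i)
  (smooth_fun_coord overlapP c j) c p cp cp.
rewrite (lieE c (dom M c)) ?setIid //; [|exact: open_in_dom overlapP c
  |exact: smooth_coord_param..].
under eq_bigr => a _ do under eq_bigr => b _ do rewrite !pderiv_coord_param //.
by under eq_bigr => a _ do rewrite sum_delta; rewrite sum_delta.
Qed.

End PoissonInCharts.

(** * The tangent bundle *)

Section TangentBundle.
Variables (R : realType) (n : nat) (M : atlas R n).
Hypothesis hM : manifold M.
Let TM := tangent_bundle M.
Implicit Types (c d : Defs.index M) (p : Defs.point M) (q : Defs.point TM).

Let chart_atP p : dom M (chart_at M p) p.
Proof. by case: hM. Qed.

Let paramK := manifold_paramK hM.
Let overlapP := manifold_overlap hM.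

(** Every y is the fibre coordinate of some tangent vector, since the
    differentials of the coordinate changes are invertible. *)
Lemma tangent_chart_image c (W : set (Defs.point M)) :
  chart TM c @` ((fun q => W q.1) `&` dom TM c) =
  [set z | (chart M c @` (W `&` dom M c)) (lsubmx z)].
Proof.
apply/seteqP; split=> [_ [[p v] [/= Wp cp] <-]|z [p [Wp cp] px]].
  by rewrite /= row_mxKl; exists p.
exists (p, rsubmx z *m 'J (transition c (chart_at M p)) (lsubmx z)) => //=.
rewrite -px -mulmxA (jacobian_transition_comp paramK overlapP) //.
by rewrite (jacobian_transition_id paramK overlapP) // mulmx1 px hsubmxK.
Qed.

Lemma tangent_dom_image c :
  chart TM c @` dom TM c = [set z | (chart M c @` dom M c) (lsubmx z)].
Proof.
have := tangent_chart_image c setT; rewrite setTI => <-.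
by congr (_ @` _); apply/seteqP; split=> [q cq|q []].
Qed.

Lemma tangent_overlap c d :
  @overlap _ _ TM c d = [set z | overlap c d (lsubmx z)].
Proof. by rewrite /overlap setIC tangent_chart_image setIC. Qed.

Lemma tangent_paramK c q : dom TM c q -> param TM c (chart TM c q) = q.
Proof.
case: q => p v /= cp; rewrite row_mxKl row_mxKr paramK //.
by rewrite -mulmxA (jacobian_transition_comp paramK overlapP) //
  (jacobian_transition_id paramK overlapP) // mulmx1.
Qed.

(** The reference chart at the base point, in which tangent vectors are
    recorded, drops out by the cocycle identity. *)
Lemma tangent_transition c d z : overlap c d (lsubmx z) ->
  @transition _ _ TM c d z = tangent_map (transition c d) z.
Proof.
move=> zcd; have dcd : differentiable (transition c d) (lsubmx z).
  exact: smooth_map_diff (overlapP c d).2 zcd.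
rewrite /tangent_map (tdiff_mxE dcd).
transitivity (let p := param M c (lsubmx z) in let a := chart_at M p in
  row_mx (chart M d p) (rsubmx z *m 'J (transition c a) (lsubmx z)
    *m 'J (transition a d) (chart M a p))); first by [].
case: zcd => p [cp dp] px /=; rewrite -px (paramK cp) (transition_chart paramK d cp).
by rewrite -mulmxA (jacobian_transition_comp paramK overlapP cp (chart_atP p) dp).
Qed.

Lemma tangent_overlapP c d : open (@overlap _ _ TM c d) /\
  smooth_map_on (@overlap _ _ TM c d) (@transition _ _ TM c d).
Proof.
have [oO sO] := overlapP c d; have oT := open_total oO.
rewrite tangent_overlap; split=> // i.
apply: eq_smooth_on (smooth_tangent_map oO sO i) => // z zcd.
by rewrite tangent_transition.
Qed.

Lemma tangent_open_in (W : set (Defs.point M)) :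
  open_in W -> @open_in _ _ TM (fun q => W q.1).
Proof.
by move=> oW c; rewrite tangent_chart_image; apply: open_total; exact: oW.
Qed.

(** Tangent vectors at distinct points are separated by open sets of M, and
    distinct tangent vectors at one point lie in the domain of one chart. *)
Lemma tangent_manifold : manifold TM.
Proof.
case: hM => _ _ _ hausM [J cJ MJ]; split.
- by move=> [p v]; exact: chart_atP.
- exact: tangent_paramK.
- exact: tangent_overlapP.
- move=> [p v] [p' v'] pq; have [pp'|/hausM] := pselect (p = p').
    have dp : dom TM (chart_at M p) (p, v) by exact: chart_atP.
    have dp' : dom TM (chart_at M p) (p', v') by rewrite /= -pp'; exact: chart_atP.
    exact: (@separate_in_chart _ _ TM tangent_paramK tangent_overlapP _ _ _ dp dp' pq).
  move=> [V [W [oV oW Vp Wp' VW]]].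
  exists (fun q => V q.1), (fun q => W q.1); split=> //.
  + exact: tangent_open_in.
  + exact: tangent_open_in.
  apply/seteqP; split=> // q VWq.
  by have : (V `&` W) q.1 by []; rewrite VW.
by exists J => // -[p v]; exact: MJ.
Qed.

Lemma tangent_jacobian c d z : overlap c d (lsubmx z) ->
  'J (@transition _ _ TM c d) z = 'J (tangent_map (transition c d)) z.
Proof.
move=> zcd; have [oO sO] := overlapP c d; apply/esym; apply: near_jacobian.
  by apply: (open_near (open_total oO) zcd) => w wcd; rewrite tangent_transition.
exact: smooth_map_diff (smooth_tangent_map oO sO) zcd.
Qed.

Lemma overlap_dom c d : overlap c d `<=` chart M c @` dom M c.
Proof. by move=> _ [p [cp _] <-]; exists p. Qed.

Lemma transition_dom c d x : overlap c d x -> (chart M d @` dom M d) (transition c d x).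
Proof. by move=> [p [cp dp] <-]; rewrite (transition_chart paramK) //; exists p. Qed.

Lemma tangent_bivector_field (P : bcomponents M) :
  bivector_field P -> bivector_field (tangent_poisson P).
Proof.
move=> [sP aP tP]; have oU c := open_chart_dom overlapP c.
have aP' c x i j : (chart M c @` dom M c) x -> P c x i j = - P c x j i.
  by move=> cx; exact: antisym_entry (aP c x cx).
split=> [c i j|c z|c d z].
- rewrite tangent_dom_image.
  exact: (smooth_lift_bivector (oU c) (sP c) (aP' c)).
- rewrite tangent_dom_image.
  exact: (lift_bivector_antisym (oU c) (sP c) (aP' c)).
rewrite tangent_overlap => zcd.
rewrite tangent_transition // tangent_jacobian //.
have [oO sO] := overlapP c d.
apply: (lift_bivector_transform oO sO (@transition_dom c d)) => //.
- by move=> i j; apply: sub_smooth_on (@overlap_dom c d) (sP c i j).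
- by move=> x /overlap_dom; exact: aP.
- exact: tP.
Qed.

(** The coefficients of the complete lift are those of X and their total
    derivatives: this is the tangent map of the coefficient map of X. *)
Lemma complete_liftE (X : vcomponents M) c : complete_lift X c = tangent_map (X c).
Proof.
apply/funext => z; congr row_mx; apply/rowP => i; rewrite !mxE.
by apply: eq_bigr => s _.
Qed.

Lemma lift_vector_field (X : vcomponents M) : vector_field X ->
  vector_field (complete_lift X) /\ vector_field (vertical_lift X).
Proof.
move=> [sX tX]; have oU c := open_chart_dom overlapP c.
have tr c d z : overlap c d (lsubmx z) ->
    tangent_map (X d) (tangent_map (transition c d) z) =
      tangent_map (X c) z *m 'J (tangent_map (transition c d)) z /\
    lift_vertical (X d) (tangent_map (transition c d) z) =
      lift_vertical (X c) z *m 'J (tangent_map (transition c d)) z.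
  move=> zcd; have [oO sO] := overlapP c d.
  apply: (lift_vector_transform oO sO (@transition_dom c d)) => //.
    by move=> i; apply: sub_smooth_on (@overlap_dom c d) (sX c i).
  exact: tX.
split; split.
- move=> c; rewrite complete_liftE tangent_dom_image.
  exact: smooth_tangent_map (oU c) (sX c).
- move=> c d z; rewrite tangent_overlap => zcd.
  rewrite !complete_liftE tangent_transition // tangent_jacobian //.
  exact: (tr _ _ _ zcd).1.
- move=> c; rewrite tangent_dom_image.
  exact: (smooth_lift_vertical (oU c) (sX c)).
move=> c d z; rewrite tangent_overlap => zcd.
rewrite tangent_transition // tangent_jacobian //.
exact: (tr _ _ _ zcd).2.
Qed.

End TangentBundle.

Theorem theorem1 (R : realType) (N : nat) (M : atlas R N)
    (pi : bcomponents M) (X : vcomponents M)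
    (hpi : poisson_manifold pi) (hX : poisson_vector_field pi X) :
  [/\ poisson_manifold (tangent_poisson pi),
      poisson_vector_field (tangent_poisson pi) (complete_lift X)
    & poisson_vector_field (tangent_poisson pi) (vertical_lift X)].
Proof.
have [hM bpi jpi] := hpi; have [sP aP _] := bpi; have vX := hX.1.
have [sX _] := vX.
have oU c := open_chart_dom (manifold_overlap hM) c.
have aP' c x i j : (chart M c @` dom M c) x -> pi c x i j = - pi c x j i.
  by move=> cx; exact: antisym_entry (aP c x cx).
have hTM := tangent_manifold hM.
have bTpi := tangent_bivector_field hM bpi.
have [vXC vXV] := lift_vector_field hM vX.
have jacP := (jacobiP hM bpi).1 jpi.
have lieP := (poisson_vector_fieldP hM bpi vX).1 hX.
split.
- split=> //; apply/(jacobiP hTM bTpi) => c z.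
  rewrite (tangent_dom_image hM) => cz a b e.
  exact: (jacobiator_lift (oU c) (sP c) (aP' c) cz a b e (jacP c)).
- apply/(poisson_vector_fieldP hTM bTpi vXC) => c z.
  rewrite (tangent_dom_image hM) complete_liftE => cz a b.
  exact: (lie_bivector_complete (oU c) (sP c) (aP' c) (sX c) cz a b (lieP c)).
apply/(poisson_vector_fieldP hTM bTpi vXV) => c z.
rewrite (tangent_dom_image hM) => cz a b.
exact: (lie_bivector_vertical (oU c) (sP c) (aP' c) (sX c) cz a b (lieP c)).
Qed.
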